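(* Let $G$ be a controllable-choice MSG over processes $\mathcal{P}$ and message labels $\mathcal{C}$. Then there exist a finite set $D$ of control data and a deadlock-free CFM $\mathcal{A}$ over processes $\mathcal{P}$ and message labels $\mathcal{C}\times D$ such that $h(\mathcal{L}(\mathcal{A}))=\mathcal{L}(G)$, where $h$ is the letter-to-letter morphism mapping $p!q((m,d))\mapsto p!q(m)$ and $p?q((m,d))\mapsto p?q(m)$. In particular, $G$ is realizable by a deadlock-free CFM whose messages carry bounded additional control data.
   Context: bMSC, MSG: A basic Message Sequence Chart (bMSC) is a tuple $M=(E,<,\mathcal{P},\mathcal{T},P,\mathcal{M},l)$ where $E$ is a finite set of events, $\mathcal{T}:E\to\{\mathrm{send},\mathrm{receive}\}$, $P:E\to\mathcal{P}$, $\mathcal{M}$ a bijection from sends to receives with $P(e)\neq P(\mathcal{M}(e))$ (messages), $l$ labels messages in $\mathcal{C}$, and the visual order $<$ is the reflexive-transitive closure of $\mathcal{M}\cup\bigcup_p<_p$ with $<_p$ a total order on $P^{-1}(p)$; $<$ is a partial order and the bMSC is FIFO (for messages $(e,f),(e',f')$: $e<_pe'$ and $P(f)=P(f')=p'$ imply $f<_{p'}f'$). Events are letters of $\Sigma=\{p!q(m)\}\cup\{q?p(m)\}$ ($p!q(m)$: $p$ sends $m$ to $q$; $q?p(m)$: $q$ receives $m$ from $p$); $\mathcal{L}(M)$ is the set of linearizations (words listing all events in an order consistent with $<$). Weak sequential composition $M_1\cdot M_2$: union of events with order the transitive closure of $<_1\cup<_2\cup\bigcup_p(P_1^{-1}(p)\times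 P_2^{-1}(p))$. An MSG is $G=(\mathcal{S},\tau,s_0,s_f,L)$: finite states, edges $\tau$, initial $s_0$ with no incoming edge, terminal $s_f$ with no outgoing edge, all nodes reachable from $s_0$ and $s_f$ reachable from all nodes, $L$ labels nodes by bMSCs. Paths, runs (paths from $s_0$ to $s_f$), $L(s_1\dots s_k)=L(s_1)\cdots L(s_k)$, $\mathcal{L}(G)=\bigcup_{\sigma\text{ run}}\mathcal{L}(L(\sigma))$. Controllable-choice: $p$ initiates $M$ if some event of $M$ on $p$ is minimal in $<$. $\mathrm{triggers}(s)$ is the set of $p$ such that some nonempty path $\sigma_1\dots\sigma_n$ with $(s,\sigma_1)\in\tau$ has $p$ initiating $L(\sigma)$. A choice node has more than one outgoing edge; it is local-choice iff its triggers set is a singleton. A send event $e$ of bMSC $M$ is resolving for $P'\subseteq\mathcal{P}$ iff every $p\in P'$ has an event $e_p$ of $M$ on $p$ with $e<e_p$. A choice node $u$ is controllable-choice iff for every path $\sigma$ from $s_0$ to $u$, and for every path $\sigma=s_1\dots u$ with $(u,s_1)\in\tau$, $L(\sigma)$ contains a resolving event for $\mathrm{triggers}(u)$. An MSG is controllable-choice iff every choice node is local-choice or controllable-choice. CFM: a Communicating Finite-State Machine over $\mathcal{P}$ and labels $\mathcal{C}'$ is a family $(\mathcal{A}_p)_{p\in\mathcal{P}}$ of finite automata $\mathcal{A}_p=(\mathcal{S}_p,A_p,\to_p,s_p,F_p)$ with actions $A_p\subseteq\{p!q(m)\}\cup\{p?q(m)\}$ ($m\in\mathcal{C}'$), initial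 state $s_p$ and local accepting states $F_p$, communicating through unbounded FIFO channels $\mathcal{B}_{p,q}$: $p!q(m)$ appends $m$ to $\mathcal{B}_{p,q}$, $p?q(m)$ is enabled only if $m$ is at the head of $\mathcal{B}_{q,p}$ and removes it. A configuration consists of local states and channel contents; the initial configuration has all initial states and empty channels; a configuration is accepting if every $\mathcal{A}_p$ is in $F_p$ and all channels are empty. $\mathcal{L}(\mathcal{A})$ is the set of action words of executions from the initial to an accepting configuration. A configuration is a deadlock if no accepting configuration is reachable from it; the CFM is deadlock-free if no deadlock is reachable from the initial configuration. *)

(* Defs.v *)
From HB Require Import structures.
From mathcomp Require Import all_boot.

Set Implicit Arguments.
Unset Strict Implicit.
Unset Printing Implicit Defensive.

(* Snd p q m is the letter p!q(m), where p sends m to q, and Rcv p q m is the  *)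
(* letter p?q(m), where p receives m from q.                                   *)
Inductive action (P C : Type) : Type :=
  | Snd of P & P & C
  | Rcv of P & P & C.

Section ActionEq.
Variables P C : eqType.
Let code (a : action P C) :=
  match a with Snd p q m => (true, p, q, m) | Rcv p q m => (false, p, q, m) end.
Let decode (t : bool * P * P * C) : action P C :=
  let: (b, p, q, m) := t in if b then Snd p q m else Rcv p q m.
Fact action_codeK : cancel code decode. Proof. by case. Qed.
HB.instance Definition _ := Equality.copy (action P C) (can_type action_codeK).
End ActionEq.

Definition actor (P C : Type) (a : action P C) : P :=
  match a with Snd p _ _ => p | Rcv p _ _ => p end.

Definition relabel (P C C' : Type) (f : C -> C') (a : action P C) :
    action P C' :=
  match a with
  | Snd p q m => Snd p q (f m)
  | Rcv p q m => Rcv p q (f m)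
  end.

(* [sends] tells the send events from the receive events.  [mate] encodes the *)
(* bijection from sends to receives together with its inverse: it maps a send *)
(* to the matching receive and vice versa.  [ple] is the union of the         *)
(* (reflexive) process orders.                                                *)
Definition msg_edge (E : finType) (sends : pred E) (mate : E -> E) : rel E :=
  [rel e f | sends e && (f == mate e)].

Definition visual (E : finType) (sends : pred E) (mate : E -> E)
    (ple : rel E) : rel E :=
  connect [rel e f | msg_edge sends mate e f || ple e f].

(* Labels are attached to messages: both ends of a message carry its label.   *)
Record bmsc (P C : eqType) := Bmsc {
  event : finType;
  sends : pred event;
  proc : event -> P;
  mate : event -> event;
  label : event -> C;
  ple : rel event;
  mateK : involutive mate;
  sends_mate : forall e, sends (mate e) = ~~ sends e;
  proc_mate : forall e, proc (mate e) <> proc e;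
  label_mate : forall e, label (mate e) = label e;
  ple_proc : forall e f, ple e f -> proc e = proc f;
  ple_total : forall e f, proc e = proc f -> ple e f || ple f e;
  ple_anti : antisymmetric ple;
  ple_trans : transitive ple;
  visual_anti : antisymmetric (visual sends mate ple);
  bmsc_fifo : forall e e', sends e -> sends e' -> ple e e' ->
    proc (mate e) = proc (mate e') -> ple (mate e) (mate e')
}.

Definition vis (P C : eqType) (M : bmsc P C) : rel (event M) :=
  visual (@sends _ _ M) (@mate _ _ M) (@ple _ _ M).

Definition letter (P C : eqType) (M : bmsc P C) (e : event M) : action P C :=
  if sends e then Snd (proc e) (proc (mate e)) (label e)
  else Rcv (proc e) (proc (mate e)) (label e).

Definition linearization (P C : eqType) (M : bmsc P C)
    (w : seq (action P C)) : Prop :=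
  exists es : seq (event M),
    [/\ perm_eq es (enum (event M)),
        forall e f, vis e f -> index e es <= index f es
      & w = map (@letter _ _ M) es].

Section Composition.
Variables (P C : eqType) (M1 M2 : bmsc P C).

Let E : finType := (event M1 + event M2)%type.

Definition comp_sends : pred E :=
  fun x => match x with inl e => sends e | inr e => sends e end.
Definition comp_proc (x : E) : P :=
  match x with inl e => proc e | inr e => proc e end.
Definition comp_mate (x : E) : E :=
  match x with inl e => inl (mate e) | inr e => inr (mate e) end.
Definition comp_label (x : E) : C :=
  match x with inl e => label e | inr e => label e end.
Definition comp_ple : rel E := fun x y =>
  match x, y with
  | inl e, inl f => ple e f
  | inr e, inr f => ple e f
  | inl e, inr f => proc e == proc f
  | inr _, inl _ => false
  end.

Let cvis := visual comp_sends comp_mate comp_ple.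

Fact cvis_rl e f : cvis (inr e) (inl f) = false.
Proof.
apply/negP => /connectP[p pp def_f].
suff: forall e0, path [rel x y | msg_edge comp_sends comp_mate x y
    || comp_ple x y] (inr e0) p -> exists e1, last (inr e0) p = inr e1.
  by move=> /(_ e pp)[e1]; rewrite -def_f.
elim: p {pp def_f} => [|[a|a] p IHp] e0 /=; first by exists e0.
  by rewrite /msg_edge /= andbF.
by case/andP=> _ /IHp.
Qed.

Fact cvis_ll e f : cvis (inl e) (inl f) = vis e f.
Proof.
apply/idP/idP => /connectP[p]; last first.
  elim: p e => [|a p IHp] e /= => [_ ->|/andP[ea pp] def_f].
    exact: connect0.
  by apply: connect_trans (IHp _ pp def_f); apply: connect1.
elim: p e => [|[a|a] p IHp] e /=.
- by move=> _ [->]; apply: connect0.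
- case/andP=> ea pp def_f; apply: connect_trans (IHp _ pp def_f).
  exact: connect1.
- case/andP=> _ pp def_f.
  suff: cvis (inr a) (inl f) by rewrite cvis_rl.
  by apply/connectP; exists p.
Qed.

Fact cvis_rr e f : cvis (inr e) (inr f) = vis e f.
Proof.
apply/idP/idP => /connectP[p]; last first.
  elim: p e => [|a p IHp] e /= => [_ ->|/andP[ea pp] def_f].
    exact: connect0.
  by apply: connect_trans (IHp _ pp def_f); apply: connect1.
elim: p e => [|[a|a] p IHp] e /=.
- by move=> _ [->]; apply: connect0.
- by rewrite /msg_edge /= andbF.
- case/andP=> ea pp def_f; apply: connect_trans (IHp _ pp def_f).
  exact: connect1.
Qed.

Fact comp_mateK : involutive comp_mate.
Proof. by case=> e /=; rewrite mateK. Qed.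

Fact comp_sends_mate x : comp_sends (comp_mate x) = ~~ comp_sends x.
Proof. by case: x => e /=; rewrite sends_mate. Qed.

Fact comp_proc_mate x : comp_proc (comp_mate x) <> comp_proc x.
Proof. by case: x => e /=; apply: proc_mate. Qed.

Fact comp_label_mate x : comp_label (comp_mate x) = comp_label x.
Proof. by case: x => e /=; rewrite label_mate. Qed.

Fact comp_ple_proc x y : comp_ple x y -> comp_proc x = comp_proc y.
Proof. by case: x y => e [] f //=; [apply: ple_proc|move/eqP|apply: ple_proc]. Qed.

Fact comp_ple_total x y :
  comp_proc x = comp_proc y -> comp_ple x y || comp_ple y x.
Proof.
case: x y => e [] f /= ef; try exact: ple_total; last by rewrite ef eqxx.
by rewrite ef eqxx.
Qed.

Fact comp_ple_anti : antisymmetric comp_ple.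
Proof. by case=> e [] f //=; rewrite ?andbF // => /ple_anti->. Qed.

Fact comp_ple_trans : transitive comp_ple.
Proof.
case=> f [] e [] g //=; try exact: ple_trans.
- by move=> /ple_proc->.
- by move=> /eqP-> /ple_proc->.
Qed.

Fact comp_visual_anti : antisymmetric cvis.
Proof.
case=> e [] f; rewrite ?cvis_rl ?andbF ?cvis_ll ?cvis_rr //.
  by move=> /visual_anti->.
by move=> /visual_anti->.
Qed.

Fact comp_fifo x y : comp_sends x -> comp_sends y -> comp_ple x y ->
  comp_proc (comp_mate x) = comp_proc (comp_mate y) ->
  comp_ple (comp_mate x) (comp_mate y).
Proof.
by case: x y => e [] f //= se sf ef; try exact: bmsc_fifo; move/eqP.
Qed.

Definition comp : bmsc P C :=
  Bmsc comp_mateK comp_sends_mate comp_proc_mate comp_label_mate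
       comp_ple_proc comp_ple_total comp_ple_anti comp_ple_trans
       comp_visual_anti comp_fifo.

(* The visual order of the composition is the closure of the two visual       *)
(* orders and of the pairs of events located on the same process.             *)
Lemma comp_visE : @vis _ _ comp =2 connect (fun x y : E =>
  match x, y with
  | inl e, inl f => vis e f
  | inr e, inr f => vis e f
  | inl e, inr f => proc e == proc f
  | inr _, inl _ => false
  end).
Proof.
move=> x y; apply/idP/idP; apply: connect_sub => {}x {}y.
  case: x y => e [] f /=; rewrite /msg_edge /= ?andbF // => ef.
  - by apply: connect1; apply: connect1.
  - exact: connect1.
  - by apply: connect1; apply: connect1.
rewrite -[connect _ x y]/(cvis x y); case: x y => e [] f //= ef.
- by rewrite cvis_ll.
- by apply: connect1; rewrite /= ef orbT.
- by rewrite cvis_rr.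
Qed.

End Composition.

Record msg (P C : eqType) := Msg {
  node : finType;
  edge : rel node;
  source : node;
  sink : node;
  chart : node -> bmsc P C;
  source_in : forall s, ~~ edge s source;
  sink_out : forall s, ~~ edge sink s;
  source_reach : forall s, connect edge source s;
  sink_reach : forall s, connect edge s sink
}.

Section MSG.
Variables (P C : eqType) (G : msg P C).
Implicit Types (s u : node G) (q : seq (node G)).

(* A path is given by its first node s and the sequence q of the next ones.   *)
Fixpoint path_chart s q : bmsc P C :=
  if q is t :: q' then comp (chart s) (path_chart t q') else chart s.

Definition msg_lang (w : seq (action P C)) : Prop :=
  exists q, [/\ path (@edge _ _ G) (source G) q, last (source G) q = sink G
              & linearization (path_chart (source G) q) w].

Definition initiates (M : bmsc P C) (p : P) : Prop :=
  exists e : event M, proc e = p /\ forall f, vis f e -> f = e.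

Definition triggers s (p : P) : Prop :=
  exists t q, [/\ edge s t, path (@edge _ _ G) t q
                & initiates (path_chart t q) p].

Definition choice_node u : bool := 1 < #|[pred t | edge u t]|.

Definition local_choice u : Prop :=
  exists p, forall p', triggers u p' <-> p' = p.

(* [vis] is reflexive: the process of e needs no event other than e itself.   *)
Definition resolving (M : bmsc P C) (e : event M) (P' : P -> Prop) : Prop :=
  sends e /\ forall p, P' p -> exists f : event M, proc f = p /\ vis e f.

Definition controllable_node u : Prop :=
  (forall q, path (@edge _ _ G) (source G) q -> last (source G) q = u ->
     exists e : event (path_chart (source G) q), resolving e (triggers u))
  /\
  (forall t q, edge u t -> path (@edge _ _ G) t q -> last t q = u ->
     exists e : event (path_chart t q), resolving e (triggers u)).

Definition controllable_choice : Prop :=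
  forall u, choice_node u -> local_choice u \/ controllable_node u.

End MSG.

(* The transition relation is a finite set, hence given by a sequence, as the *)
(* set of messages need not be finite; it may be nondeterministic.            *)
Record automaton (A : eqType) := Automaton {
  state : finType;
  alphabet : seq A;
  trans : seq (state * A * state);
  start : state;
  accept : pred state;
  trans_alphabet : forall x a y, (x, a, y) \in trans -> a \in alphabet
}.

Record cfm (P C : eqType) := Cfm {
  machine : P -> automaton (action P C);
  machine_actor : forall p a, a \in alphabet (machine p) -> actor a = p
}.

Section CFM.
Variables (P C : eqType) (A : cfm P C).

(* [chan c p q] is the content of the channel from p to q, oldest first.      *)
Record config := Config {
  local : forall p, state (machine A p);
  chan : P -> P -> seq C
}.

Definition init_config : config :=
  Config (fun p => start (machine A p)) (fun _ _ => [::]).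

Definition accepting (c : config) : Prop :=
  (forall p, accept (local c p)) /\ (forall p q, chan c p q = [::]).

Definition chan_step (a : action P C) (b b' : P -> P -> seq C) : Prop :=
  match a with
  | Snd p q m => b' p q = rcons (b p q) m /\
      forall r s, (r, s) != (p, q) -> b' r s = b r s
  | Rcv p q m => b q p = m :: b' q p /\
      forall r s, (r, s) != (q, p) -> b' r s = b r s
  end.

Definition step (c : config) (a : action P C) (c' : config) : Prop :=
  [/\ (local c (actor a), a, local c' (actor a)) \in trans (machine A (actor a)),
      forall r, r != actor a -> local c' r = local c r
    & chan_step a (chan c) (chan c')].

Fixpoint exec (c : config) (w : seq (action P C)) (c' : config) : Prop :=
  if w is a :: w' then exists d, step c a d /\ exec d w' c' else c = c'.

Definition reachable (c c' : config) : Prop := exists w, exec c w c'.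

Definition cfm_lang (w : seq (action P C)) : Prop :=
  exists c, exec init_config w c /\ accepting c.

Definition deadlock (c : config) : Prop :=
  ~ exists c', reachable c c' /\ accepting c'.

Definition deadlock_free : Prop :=
  ~ exists c, reachable init_config c /\ deadlock c.

End CFM.

(* Main.v *)
Require Import Defs.
From mathcomp Require Import all_boot.
From mathcomp Require Import boolp.
From mathcomp Require Import zify.

Set Implicit Arguments.
Unset Strict Implicit.
Unset Printing Implicit Defensive.

(** Call an event e of a chart ending in a choice node u good for u if every
process of triggers(u) has an event above e.  Every event of a continuation
after u lies above a minimal one, hence above e, so the process executing e
may choose the whole continuation and let the information travel on the
existing messages.  If u is local-choice, every event of its process is good;
if u is controllable-choice, resolving events are good.  Hence a cycle on a
choice node has no events at all, and can be erased, or contains a good event,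
and every run splits into phases of bounded length, each of which ends in the
sink or contains a good event for its last node.  These good events are
totally ordered, and each of them decides the next phase.  Only the path up to
the first choice node may lack a good event; the choice is then local to a
process that has no event yet, and is made by its first event.

A process that has finished a phase without being informed of the next one
must not receive a message that overtakes its next event, however late it is.
Therefore each decision also fixes, for every process, in which phase it takes
part next, and later decisions keep this promise.  No promise is available
during the first phase; there, messages record which processes have taken part
since.

Since channels are FIFO, a word linearizes a chart iff its projection on each
process is the sequence of events of this process, and no prefix has more
receives than sends on a channel. *)

(** * Words and charts *)

Section Words.
Variables P C : eqType.
Implicit Types (p q : P) (a : action P C) (w : seq (action P C)).

Definition is_snd p q a :=
  if a is Snd p' q' _ then (p' == p) && (q' == q) else false.

Definition is_rcv p q a :=
  if a is Rcv p' q' _ then (p' == p) && (q' == q) else false.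

Definition proj w p := [seq a <- w | actor a == p].

Definition causal w := forall n p q,
  count (is_rcv q p) (take n w) <= count (is_snd p q) (take n w).

End Words.

(** * Process words of a chart, and linearizations characterized by them *)

Section Events.
Variables (P C : eqType) (M : bmsc P C).
Implicit Types (p q : P) (e f : event M).

Definition evs p : seq (event M) :=
  sort (@ple _ _ M) [seq e <- enum (event M) | proc e == p].

Definition profile p : seq (action P C) := map (@letter _ _ M) (evs p).

Lemma mem_evs p e : (e \in evs p) = (proc e == p).
Proof. by rewrite mem_sort mem_filter mem_enum andbT. Qed.

Lemma evs_uniq p : uniq (evs p).
Proof. by rewrite sort_uniq filter_uniq // enum_uniq. Qed.

Lemma evs_sorted p : sorted (@ple _ _ M) (evs p).
Proof.
apply: (@sort_sorted_in _ [pred e | proc e == p]); last first.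
  by rewrite all_filter; apply/allP => e _ /=; apply/implyP.
by move=> e f /eqP ep /eqP fp; apply: ple_total; rewrite ep.
Qed.

Lemma evs_pairwise p : pairwise (@ple _ _ M) (evs p).
Proof. by rewrite -sorted_pairwise ?evs_sorted //; apply: ple_trans. Qed.

(** The FIFO condition makes [mate] monotone on the sends from [p] to [q], so both sides are sorted
    lists of the same receives: the messages of a channel are received in the order in which they
    are sent. *)
Lemma evs_fifo p q :
  [seq e <- evs q | ~~ sends e && (proc (mate e) == p)] =
  map (@mate _ _ M) [seq e <- evs p | sends e && (proc (mate e) == q)].
Proof.
apply: (sorted_eq (@ple_trans _ _ M) (@ple_anti _ _ M)).
- by apply: sorted_filter; [apply: ple_trans|apply: evs_sorted].
- have /= := sorted_filter (@ple_trans _ _ M)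
    (fun e => sends e && (proc (mate e) == q)) (evs_sorted p).
  apply: (@homo_sorted_in _ _ [pred e | sends e && (proc (mate e) == q)]).
    move=> e f /andP[se /eqP me] /andP[sf /eqP mf] ef.
    by apply: bmsc_fifo => //; rewrite me mf.
  by apply: filter_all.
apply: uniq_perm.
- by rewrite filter_uniq ?evs_uniq.
- by rewrite map_inj_uniq ?filter_uniq ?evs_uniq //;
    apply: inv_inj (@mateK _ _ M).
move=> e; rewrite -{2}[e](@mateK _ _ M) mem_map;
  last exact: inv_inj (@mateK _ _ M).
rewrite !mem_filter !mem_evs mateK sends_mate.
by case: (sends e) => //=; rewrite andbC.
Qed.

Lemma letter_actor e : actor (letter e) = proc e.
Proof. by rewrite /letter; case: ifP. Qed.

Lemma letter_snd p q e :
  is_snd p q (letter e) = [&& sends e, proc e == p & proc (mate e) == q].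
Proof. by rewrite /letter; case: ifP. Qed.

Lemma letter_rcv p q e :
  is_rcv q p (letter e) = [&& ~~ sends e, proc e == q & proc (mate e) == p].
Proof. by rewrite /letter; case: ifP. Qed.

Lemma vis_ple e f : ple e f -> vis e f.
Proof. by move=> ef; apply: connect1; rewrite /= ef orbT. Qed.

Lemma vis_mate e : sends e -> vis e (mate e).
Proof. by move=> se; apply: connect1; rewrite /= /msg_edge /= se eqxx. Qed.

Lemma filter_sends p q (s : seq (event M)) :
  [seq e <- s | [&& sends e, proc e == p & proc (mate e) == q]] =
  [seq e <- [seq e <- s | proc e == p] | sends e && (proc (mate e) == q)].
Proof. by rewrite -filter_predI; apply: eq_filter => e /=; do !case: (_ == _);
  case: sends. Qed.

Lemma filter_rcvs p q (s : seq (event M)) :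
  [seq e <- s | [&& ~~ sends e, proc e == q & proc (mate e) == p]] =
  [seq e <- [seq e <- s | proc e == q] | ~~ sends e && (proc (mate e) == p)].
Proof. by rewrite -filter_predI; apply: eq_filter => e /=; do !case: (_ == _);
  case: sends. Qed.

(** Reads a word back as a list of events: each letter consumes the first event still waiting in the
    list of its process. The empty results on a missing event are fillers. *)
Fixpoint lift_word (w : seq (action P C)) (T : P -> seq (event M)) :=
  if w is a :: w' then
    if T (actor a) is e :: s then
      e :: lift_word w' (fun p => if p == actor a then s else T p)
    else [::]
  else [::].

Lemma lift_wordP w T :
    (forall p, proj w p = map (@letter _ _ M) (T p)) ->
    (forall p e, e \in T p -> proc e = p) ->
  map (@letter _ _ M) (lift_word w T) = w /\
  forall p, [seq e <- lift_word w T | proc e == p] = T p.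
Proof.
elim: w T => [|a w IHw] T wT Tp /=.
  by split=> // p; move: (wT p) => /=; case: (T p).
have := wT (actor a); rewrite /= eqxx; case defT: (T (actor a)) => [|e s] //=.
case=> a_e ws; have pe: proc e = actor a by apply: Tp; rewrite defT mem_head.
have [||-> IHT] := IHw (fun p => if p == actor a then s else T p).
- move=> p; case: eqP => [->//|/eqP np]; rewrite -wT /= /proj /=.
  by rewrite eq_sym (negPf np).
- move=> p f; case: eqP => [->|_] fs; last exact: Tp.
  by apply: Tp; rewrite defT inE fs orbT.
split; first by rewrite -a_e.
move=> p; rewrite pe IHT [p == _]eq_sym; case: eqP => [<-|//].
by rewrite defT.
Qed.

Lemma linearization_proj w : linearization M w ->
  (forall p, proj w p = profile p) /\ causal w.
Proof.
case=> es [es_enum es_vis ->].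
have es_uniq: uniq es by rewrite (perm_uniq es_enum) enum_uniq.
have es_mem e : e \in es by rewrite (perm_mem es_enum) mem_enum.
have es_evs p : [seq e <- es | proc e == p] = evs p.
  apply: (sorted_eq (@ple_trans _ _ M) (@ple_anti _ _ M)).
  - rewrite sorted_pairwise; last exact: ple_trans.
    have: pairwise (fun e f => (proc e == proc f) ==> ple e f) es.
      case: es es_enum es_vis es_uniq es_mem => // e0 es'.
      move: (e0 :: es') => es _ es_vis es_uniq es_mem.
      apply/(pairwiseP e0) => i j; rewrite !inE => ilt jlt ij.
      apply/implyP => /eqP pij; have /orP[//|/vis_ple] := ple_total pij.
      by move/es_vis; rewrite !index_uniq // leqNgt ij.
    elim: es {es_enum es_vis es_uniq es_mem} => //= e s IHs /andP[es /IHs ps].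
    case: eqP => //= pe; rewrite ps andbT all_filter.
    apply: sub_all es => f /implyP ef; apply/implyP => /eqP pf.
    by apply: ef; rewrite pe pf.
  - exact: evs_sorted.
  apply: uniq_perm; rewrite ?filter_uniq ?evs_uniq // => e.
  by rewrite mem_filter es_mem mem_evs andbT.
split=> [p|n p q].
  rewrite /proj filter_map /profile -es_evs; congr map.
  by apply: eq_filter => e /=; rewrite letter_actor.
(* [mate] injects the receives of the prefix into its sends, because a send lies below its receive
   and hence in every prefix that contains the receive. *)
rewrite -map_take !count_map -!size_filter -(size_map (@mate _ _ M)).
apply: uniq_leq_size.
  rewrite map_inj_uniq; last exact: inv_inj (@mateK _ _ M).
  by rewrite filter_uniq // take_uniq.
move=> _ /mapP[e + ->]; rewrite mem_filter /= letter_rcv in_take //.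
case/andP=> /and3P[re pe pm] en; rewrite mem_filter in_take //= letter_snd.
rewrite sends_mate re mateK pe pm /=; apply: leq_ltn_trans en; apply: es_vis.
by rewrite -{2}[e](@mateK _ _ M) vis_mate // sends_mate.
Qed.

Lemma proj_linearization w : (forall p, proj w p = profile p) -> causal w ->
  linearization M w.
Proof.
move=> wM w_causal; have [|es_w es_evs] := lift_wordP wM.
  by move=> p e; rewrite mem_evs => /eqP.
move: (lift_word w evs) es_w es_evs => es es_w es_evs.
have perm_es: perm_eq es (enum (event M)).
  apply/allP => e _ /=; apply/eqP.
  suff cnt s : count_mem e s = count_mem e [seq f <- s | proc f == proc e].
    rewrite [LHS]cnt es_evs [RHS]cnt !count_uniq_mem ?evs_uniq //.
      by rewrite mem_evs mem_filter mem_enum eqxx.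
    by rewrite filter_uniq ?enum_uniq.
  by rewrite count_filter; apply: eq_count => f /=; case: (f =P e) => // ->;
    rewrite eqxx.
have es_uniq: uniq es by rewrite (perm_uniq perm_es) enum_uniq.
have es_mem e : e \in es by rewrite (perm_mem perm_es) mem_enum.
exists es; split=> // e f /connectP[s]; elim: s e => [|g s IHs] e /=.
  by move=> _ ->.
case/andP=> eg gevents /(IHs _ gevents); apply: leq_trans => {s IHs gevents f}.
rewrite leqNgt; apply/negP => gevent; case/orP: eg => [/andP[se /eqP gE]|eg].
  (* Suppose the receive [g] stood before its send [e]. In the prefix ending with [g], the receives
     of this channel are, by [evs_fifo], the mates of its first sends. By causality they are no more
     than the sends in the prefix, so [e] would be one of these. *)
  subst g; set g := mate e in gevent *; set p := proc e; set q := proc g.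
  have := w_causal (index g es).+1 p q; rewrite -es_w -map_take !count_map.
  rewrite -!size_filter; set t := take _ es; set d := drop (index g es).+1 es.
  have es_td: es = t ++ d by rewrite cat_take_drop.
  set R := filter _ _; set S := filter _ _ => RS.
  have := evs_fifo p q; rewrite -!es_evs -filter_rcvs -filter_sends es_td.
  rewrite !filter_cat map_cat => def_R.
  have RE: R = [seq e0 <- t | [&& ~~ sends e0, proc e0 == q & proc (mate e0) == p]].
    by apply: eq_filter => x; apply: letter_rcv.
  have SE: S = [seq e0 <- t | [&& sends e0, proc e0 == p & proc (mate e0) == q]].
    by apply: eq_filter => x; apply: letter_snd.
  move: def_R; rewrite -RE -SE => def_R.
  have gR: g \in R.
    rewrite RE mem_filter /q eqxx sends_mate se /= mateK eqxx /=.
    by rewrite /t in_take // ltnSn.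
  have gS: g \in map (@mate _ _ M) S.
    move/(congr1 (take (size R))): def_R; rewrite take_size_cat // => ER.
    move: gR; rewrite {1}ER take_cat size_map ltn_neqAle RS andbT.
    case: eqP => /= [->|_]; last exact: mem_take.
    by rewrite subnn take0 cats0.
  case/mapP: gS => e' e'S /(inv_inj (@mateK _ _ M)) e'E; rewrite -e'E in e'S.
  move: e'S; rewrite SE mem_filter => /andP[_]; rewrite in_take // ltnS.
  by rewrite leqNgt gevent.
(* For an edge of the process order, [es] lists the events of this process as [evs] does, so [e] and
   [g] would precede each other. *)
have gp: proc g = proc e by rewrite (ple_proc eg).
have := gevent; have /splitPr es_g := es_mem g;
  case: es_g es_evs es_uniq (es_mem e).
move=> s1 s2 es_evs; rewrite cat_uniq index_cat /= eqxx addn0.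
case/and3P=> _ /norP[gs1 _] _; rewrite (negPf gs1) mem_cat inE index_cat /=.
case: ifP => [es1 _|_ /= e_s2]; first by rewrite ltnNge ltnW // index_mem.
rewrite eq_sym; case: eqP e_s2 => [_|_ /= e_s2 _]; first by rewrite addn0 ltnn.
have := evs_pairwise (proc e); rewrite -es_evs filter_cat /= gp eqxx.
rewrite pairwise_cat /= => /and4P[_ _ /allP/(_ e) ge' _].
have: e = g by apply: (@ple_anti _ _ M); rewrite eg ge' // mem_filter eqxx.
by move=> eg'; rewrite eg' ltnn in gevent.
Qed.

Lemma linearizationP w :
  linearization M w <-> (forall p, proj w p = profile p) /\ causal w.
Proof.
by split=> [/linearization_proj|[? ?]] //; apply: proj_linearization.
Qed.

Lemma profile0P :
  (forall p, profile p = [::]) <-> forall e : event M, False.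
Proof.
split=> [M0 e|M0 p].
  have: e \in evs (proc e) by rewrite mem_evs.
  by have /(congr1 size) := M0 (proc e); rewrite size_map; case: (evs _).
by rewrite /profile; case: (evs p) => // e; case: (M0 e).
Qed.

(** * Minimal events of the visual order *)

Definition height e := #|[pred f | vis f e]|.

Lemma height_lt e f : vis e f -> e != f -> height e < height f.
Proof.
move=> ef neq; apply/proper_card/properP; split.
  by apply/subsetP => g; rewrite !inE => /connect_trans; apply.
exists f; rewrite !inE; first exact: connect0.
by apply: contra neq => fe; apply/eqP/(@visual_anti _ _ M)/andP.
Qed.

Lemma minimal_event e : exists f, vis f e /\ forall g, vis g f -> g = f.
Proof.
have [n] := ubnP (height e); elim: n e => // n IHn e; rewrite ltnS => le_n.
have [/existsP[f /andP[fe neq]]|] := boolP [exists f, vis f e && (f != e)].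
  have [|g [gf min_g]] := IHn f; first exact: leq_trans (height_lt fe neq) _.
  by exists g; split=> //; apply: connect_trans gf fe.
rewrite negb_exists => /forallP e_min; exists e; split; first exact: connect0.
by move=> f fe; have := e_min f; rewrite fe negbK => /eqP.
Qed.

Lemma vis_inv e f : vis e f ->
  e = f \/ exists2 g, vis e g & (g != f) && ple g f || sends g && (f == mate g).
Proof.
move=> /connectP[s es ->]; elim/last_ind: s es => [|s g IHs]; first by left.
rewrite rcons_path last_rcons => /andP[es sg].
have [<-|neq] := eqVneq (last e s) g; first exact: IHs.
right; exists (last e s); first by apply/connectP; exists s.
by rewrite neq /= orbC.
Qed.

(** Message edges end in receives, and no event of the process precedes [e]. This is how a process
    that begins a continuation with a send turns out to be one of its triggers. *)
Lemma first_send_minimal p e s : evs p = e :: s -> sends e ->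
  forall f, vis f e -> f = e.
Proof.
move=> pe se f /vis_inv[//|[g _ /orP[/andP[ne gevent]|/andP[sg /eqP eg]]]].
  have: g \in evs p.
    by rewrite mem_evs (ple_proc gevent) -mem_evs pe mem_head.
  rewrite pe inE (negPf ne) /= => gevents; have := evs_pairwise p.
  rewrite pe /= => /andP[/allP/(_ _ gevents) eg _].
  by rewrite (@ple_anti _ _ M g e) ?eqxx ?gevent // in ne.
by rewrite eg sends_mate sg in se.
Qed.

End Events.

(** * Charts of paths *)

Section Charts.
Variables P C : eqType.

Lemma evs_comp (M1 M2 : bmsc P C) p :
  evs (Defs.comp M1 M2) p = map inl (evs M1 p) ++ map inr (evs M2 p).
Proof.
apply: (sorted_eq (@ple_trans _ _ _) (@ple_anti _ _ _)).
- exact: evs_sorted.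
- rewrite sorted_pairwise; last exact: ple_trans.
  rewrite pairwise_cat !pairwise_map !evs_pairwise !andbT.
  apply/allrelP => _ _ /mapP[e + ->] /mapP[f + ->] /=.
  by rewrite !mem_evs => /eqP-> /eqP->.
apply: uniq_perm; first exact: evs_uniq.
  rewrite cat_uniq !map_inj_uniq ?evs_uniq //; try by move=> ? ? [].
  by rewrite andbT; apply/hasPn => _ /mapP[e _ ->]; apply/mapP => -[].
case=> e; rewrite mem_evs mem_cat /=.
  rewrite mem_map ?mem_evs; last by move=> ? ? [].
  by case: eqP => //= _; apply/esym/mapP => -[].
rewrite orbC mem_map ?mem_evs; last by move=> ? ? [].
by case: eqP => //= _; apply/esym/mapP => -[].
Qed.

Lemma profile_comp (M1 M2 : bmsc P C) p :
  profile (Defs.comp M1 M2) p = profile M1 p ++ profile M2 p.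
Proof. by rewrite /profile evs_comp map_cat -!map_comp. Qed.

Lemma profile_path (G : msg P C) (s : node G) q p :
  profile (path_chart s q) p = flatten [seq profile (chart x) p | x <- s :: q].
Proof.
elim: q s => [|t q IHq] s /=; first by rewrite cats0.
by rewrite profile_comp IHq.
Qed.

(** The embedding is an iterated [inr]; composition leaves the order inside its right component
    unchanged. *)
Lemma vis_suffix (G : msg P C) (s t : node G) q1 q2 :
  exists h : event (path_chart t q2) -> event (path_chart s (q1 ++ t :: q2)),
    (forall e, proc (h e) = proc e) /\ forall e f, vis e f -> vis (h e) (h f).
Proof.
elim: q1 s => [|x q1 IHq] s /=.
  by exists inr; split=> // e f ef; rewrite /vis cvis_rr.
have [h [hp hv]] := IHq x; exists (fun e => inr (h e)); split=> [e|e f ef] /=.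
  exact: hp.
by rewrite /vis cvis_rr; apply: hv.
Qed.

End Charts.

(** * A protocol for runs cut into phases *)

(* [events_of x p] lists the events of p in phase x in order; [erank] is any
   measure that increases along the visual order of a phase.
   [decision x] is the event of phase x that chooses the next phase, and
   [informed e] says that the decision of its phase is in the past of e.
   [opener] is the process that chooses the phase after [ini] by its first
   event, if [ini] has no decision.  [promise x p] tells whether the first
   event of p after x is a send, and the other end of its message.
   [active_before x p]: p has an event in a phase strictly between [ini] and x. *)
Record phases (P C : eqType) := Phases {
  phase : finType;
  pevent : finType;
  phase_of : pevent -> phase;
  owner : pevent -> P;
  partner : pevent -> pevent;
  elabel : pevent -> C;
  esend : pred pevent;
  events_of : phase -> P -> seq pevent;
  erank : pevent -> nat;
  events_of_uniq : forall x p, uniq (events_of x p);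
  mem_events_of : forall x p e, (e \in events_of x p) = (phase_of e == x) && (owner e == p);
  partnerK : involutive partner;
  esend_partner : forall e, esend (partner e) = ~~ esend e;
  phase_of_partner : forall e, phase_of (partner e) = phase_of e;
  elabel_partner : forall e, elabel (partner e) = elabel e;
  events_of_fifo : forall x p q,
    [seq e <- events_of x q | ~~ esend e && (owner (partner e) == p)] =
    map partner [seq e <- events_of x p | esend e && (owner (partner e) == q)];
  erank_partner : forall e, esend e -> erank e < erank (partner e);
  erank_events_of : forall x p, pairwise (fun e f =>
    erank e < erank f) (events_of x p);
  nxt : rel phase;
  ini : phase;
  fin : pred phase;
  decision : phase -> option pevent;
  informed : pred pevent;
  opener : option P;
  promise : phase -> P -> option (bool * P);
  active_before : phase -> P -> bool;
  informed_decision : forall x e, decision x = Some e -> phase_of e = x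
    /\ informed e;
  informed_succ : forall x p s1 e h s2, events_of x p = s1 ++ e :: h :: s2
    -> informed e -> informed h;
  informed_partner : forall e, esend e -> informed e -> informed (partner e);
  informed_inv : forall h, informed h -> [\/ decision (phase_of h) = Some h,
    exists s1 e s2, events_of (phase_of h) (owner h) = s1 ++ e :: h :: s2
      /\ informed e |
    ~~ esend h /\ informed (partner h)];
  nxt_ini : forall x y, nxt x y -> y != ini;
  fin_decision : forall x, fin x -> decision x = None;
  nxt_decision : forall x y, nxt x y -> ~~ fin y -> decision y <> None;
  nxt_snd : forall x y p h s, nxt x y -> events_of y p = h :: s -> esend h ->
    (exists s1 g, events_of x p = rcons s1 g /\ informed g) \/ (x = ini
      /\ opener = Some p);
  opener_ini : forall r, opener = Some r ->
    [/\ events_of ini r = [::], decision ini = None & ~~ fin ini];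
  opener_nxt : forall r y, opener = Some r -> nxt ini y -> events_of y r = [::] ->
    forall p, events_of y p = [::];
  ini_reach : exists2 s, path nxt ini s & fin (last ini s);
  nxt_reach : forall x y, nxt x y -> exists2 s, path nxt y s & fin (last y s);
  promise_nxt : forall x y p, nxt x y -> x != ini ->
    promise x p = if events_of y p is e :: _ then Some (esend e, owner (partner e)) else promise y p;
  promise_fin : forall x p, x != ini -> fin x -> promise x p = None;
  active_before_ini : forall y p, nxt ini y -> active_before y p = false;
  active_before_nxt : forall x y p, nxt x y -> x != ini ->
    active_before y p = active_before x p || (events_of x p != [::])
}.

Arguments ini {P C}.
Arguments opener {P C}.

(** * Auxiliary facts on lists and channels *)

Section Aux.

Lemma uniq_split (T : eqType) (x : T) a b a' b' :
  uniq (a ++ x :: b) -> a ++ x :: b = a' ++ x :: b' -> a = a' /\ b = b'.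
Proof.
elim: a a' => [|y a IHa] [|y' a'] //=.
- by move=> _ [->].
- by move=> /andP[xb _] [_ bE]; move: xb; rewrite bE mem_cat mem_head orbT.
- by move=> /andP[ya _] [yx _]; move: ya; rewrite yx mem_cat mem_head orbT.
by move=> /andP[_ u] [-> /(IHa _ u)[-> ->]].
Qed.

Lemma ex_min_seq (T : eqType) (f : T -> nat) (s : seq T) : s != [::] ->
  exists2 x, x \in s & forall y, y \in s -> f x <= f y.
Proof.
elim: s => // x [|y s] IHs _.
  by exists x; rewrite ?mem_head // => z; rewrite inE => /eqP->.
have [//|z zs min_z] := IHs; have [le_xz|lt_zx] := leqP (f x) (f z).
  exists x; rewrite ?mem_head // => t; rewrite inE => /predU1P[->//|/min_z].
  exact: leq_trans.
exists z; first by rewrite inE zs orbT.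
move=> t; rewrite inE => /predU1P[->|/min_z//]; exact: ltnW.
Qed.

Lemma chan_step_inj (P C : eqType) (a : action P C) b b1 b2 :
  chan_step a b b1 -> chan_step a b b2 -> forall p q, b1 p q = b2 p q.
Proof.
case: a => p q m /= [E1 F1] [E2 F2] r s.
  have [[-> ->]|neq] := eqVneq (r, s) (p, q); first by rewrite E1 E2.
  by rewrite F1 ?F2.
have [[-> ->]|neq] := eqVneq (r, s) (q, p); last by rewrite F1 ?F2.
by move: E2; rewrite E1 => -[].
Qed.

End Aux.

(** * Global histories of the protocol and their invariant *)

Section Ghost.
Variables (P C : eqType) (S : phases P C).
Let N := phase S.
Let EV := pevent S.
Implicit Types (x y : N) (e h : EV) (p q r : P) (s f Psi : seq N).

Definition gevent : eqType := (nat * EV)%type.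
Implicit Types (g : gevent) (l Y : seq gevent) (X : P -> seq gevent).

(* Both the local states and the control data: an event and, if it is informed,
   the next phase. *)
Definition know : finType := (EV * option N)%type.

(* A phase may occur several times in a run: its events are tagged with the
   index of the occurrence. *)
Fixpoint gevents k Psi p : seq gevent :=
  if Psi is x :: Psi' then map (pair k) (events_of x p) ++ gevents k.+1 Psi' p else [::].

Lemma gevents_cat k Psi Psi' p :
  gevents k (Psi ++ Psi') p = gevents k Psi p ++ gevents (k + size Psi) Psi' p.
Proof.
elim: Psi k => [|x Psi IH] k /=; first by rewrite addn0.
by rewrite IH catA addSnnS.
Qed.

Lemma mem_gevents k0 Psi p k e : ((k, e) \in gevents k0 Psi p) =
  [&& k0 <= k, k < k0 + size Psi, phase_of e == nth (ini S) Psi (k - k0) & owner e == p].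
Proof.
elim: Psi k0 => [|x Psi IH] k0 /=; first by rewrite addn0; case: leqP.
rewrite mem_cat IH; have [lt_k|lt_k|<-] := ltngtP k k0.
- rewrite /= orbF; apply/mapP => -[e' _ [kE _]].
  by rewrite kE ltnn in lt_k.
- rewrite addSnnS; have ->: k - k0 = (k - k0.+1).+1 by lia.
  rewrite orb_idl //; case/mapP => e' _ [kE _].
  by rewrite kE ltnn in lt_k.
rewrite subnn /= orbF mem_map ?mem_events_of; last by move=> ? ? [].
by rewrite -[X in X < _]addn0 ltn_add2l.
Qed.

Lemma gevents_uniq k Psi p : uniq (gevents k Psi p).
Proof.
elim: Psi k => //= x Psi IH k; rewrite cat_uniq IH map_inj_uniq ?events_of_uniq.
  rewrite andbT /=; apply/hasPn => -[k' e]; rewrite mem_gevents => /andP[kk _].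
  by apply/mapP => -[e' _ [kE _]]; rewrite kE ltnn in kk.
by move=> ? ? [].
Qed.

Definition rank_bound := (\max_(e : EV) erank e).+1.
(** The lexicographic order on phase index and [erank], coded as one number; [rank_bound] exceeds
    every [erank]. *)
Definition grank g := g.1 * rank_bound + erank g.2.

Lemma erank_bound e : erank e < rank_bound.
Proof. by rewrite ltnS (leq_bigmax e). Qed.

Lemma gevents_grank k Psi p : pairwise (fun g g' =>
  grank g < grank g') (gevents k Psi p).
Proof.
elim: Psi k => //= x Psi IH k; rewrite pairwise_cat IH andbT pairwise_map.
apply/andP; split; last first.
  by apply: sub_pairwise (erank_events_of x p) => e e';
    rewrite /grank /= ltn_add2l.
apply/allrelP => _ [k' e'] /mapP[e _ ->]; rewrite mem_gevents => /andP[lt_k _].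
rewrite /grank /= -addnS; have := erank_bound e; move: rank_bound => B lt_e.
apply: leq_trans (_ : k.+1 * B <= _); first by rewrite mulSn addnC leq_add2r.
by apply: leq_trans (leq_addr _ _); rewrite leq_mul2r lt_k orbT.
Qed.

Definition snds q l : seq gevent :=
  [seq g <- l | esend g.2 && (owner (partner g.2) == q)].
Definition rcvs p l : seq gevent :=
  [seq g <- l | ~~ esend g.2 && (owner (partner g.2) == p)].
Definition gpartner g : gevent := (g.1, partner g.2).

Lemma gpartnerK : involutive gpartner.
Proof. by case=> k e; rewrite /gpartner /= partnerK. Qed.

Lemma gevents_fifo k Psi p q :
  rcvs p (gevents k Psi q) = map gpartner (snds q (gevents k Psi p)).
Proof.
elim: Psi k => //= x Psi IH k; rewrite /rcvs /snds !filter_cat map_cat.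
rewrite -[in RHS]/(snds _ _) -IH; congr (_ ++ _); rewrite /snds !filter_map.
rewrite /preim /= (events_of_fifo x p q) -!map_comp; exact: eq_map.
Qed.

Lemma mem_snds q l k e :
  ((k, e) \in snds q l) = [&& esend e, owner (partner e) == q & (k, e) \in l].
Proof. by rewrite mem_filter /= andbA. Qed.

(** By FIFO, what [p] has still to receive from [q] is first what the channel contains, then what
    [q] has still to send. *)
Lemma pending_rcvs Psi X Yp Yq p q :
    gevents 0 Psi p = X p ++ Yp -> gevents 0 Psi q = X q ++ Yq ->
    size (rcvs q (X p)) <= size (snds p (X q)) ->
  rcvs q Yp =
    map gpartner (drop (size (rcvs q (X p))) (snds p (X q)) ++ snds p Yq).
Proof.
move=> Ep Eq le_rs; have := gevents_fifo 0 Psi q p; rewrite Ep Eq /rcvs /snds.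
rewrite !filter_cat -/(rcvs _ _) -/(snds _ _) => E.
move/(congr1 (drop (size (rcvs q (X p))))): E; rewrite drop_size_cat // => ->.
by rewrite -map_drop drop_cat ltn_neqAle le_rs andbT; case: eqP => // ->;
  rewrite subnn drop0 drop_size.
Qed.

(** The list [s] omits the initial phase, so its entry at index [g.1] is the phase that follows the
    one of [g]. *)
Definition nu s g := if informed g.2 then Some (nth (ini S) s g.1) else None.

Definition lstate s l : option know :=
  if l is g :: l' then Some ((last g l').2, nu s (last g l')) else None.

Lemma lstate_rcons s l g : lstate s (rcons l g) = Some (g.2, nu s g).
Proof. by case: l => //= g' l; rewrite last_rcons. Qed.

Definition payload s g : C * know := (elabel g.2, (g.2, nu s g)).

Definition channel s X p q :=
  map (payload s) (drop (size (rcvs p (X q))) (snds q (X p))).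

(* [s] lists the phases decided so far after [ini], and [X p] the events that p
   has executed. *)
Record ginv s X : Prop := Ginv {
  g_path : path (@nxt _ _ S) (ini S) s;
  g_pre : forall p, exists Y, gevents 0 (ini S :: s) p = X p ++ Y;
  g_cnt : forall p q, size (rcvs p (X q)) <= size (snds q (X p));
  g_decision : forall k d, k < size s
    -> decision (nth (ini S) (ini S :: s) k) = Some d ->
    (k, d) \in X (owner d);
  g_informed : forall p k e, (k, e) \in X p -> informed e -> k < size s
}.

(** No phase after the initial one is decided before the opener has moved. *)
Definition opened s X := forall r, opener S = Some r -> 0 < size s -> X r != [::].

Lemma ini_first s k : path (@nxt _ _ S) (ini S) s ->
  k <= size s -> nth (ini S) (ini S :: s) k = ini S -> k = 0.
Proof.
case: k => //= k /(pathP (ini S)) s_path lt_k E; have := s_path k lt_k.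
by move/nxt_ini; rewrite E eqxx.
Qed.

Lemma gevents_next Psi p l k h Y : gevents 0 Psi p = l ++ (k, h) :: Y ->
  exists t1 t2,
   [/\ events_of (phase_of h) p = t1 ++ h :: t2,
       l = gevents 0 (take k Psi) p ++ map (pair k) t1,
       Y = map (pair k) t2 ++ gevents k.+1 (drop k.+1 Psi) p
     & [/\ k < size Psi, phase_of h = nth (ini S) Psi k & owner h = p]].
Proof.
move=> E; have := gevents_uniq 0 Psi p.
have: (k, h) \in gevents 0 Psi p by rewrite E mem_cat mem_head orbT.
rewrite mem_gevents add0n subn0 => /and4P[_ lt_k /eqP phh /eqP oh].
have [t1 [t2 sqE]]: exists t1 t2, events_of (phase_of h) p = t1 ++ h :: t2.
  have: h \in events_of (phase_of h) p by rewrite mem_events_of oh !eqxx.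
  by case/splitPr=> t1 t2; exists t1, t2.
move=> gu; exists t1, t2; have := E; move: gu;
  rewrite -{1 2}(cat_take_drop k Psi) gevents_cat.
rewrite size_take lt_k (drop_nth (ini S)) //= -phh sqE map_cat -!catA /= !add0n catA.
by move=> gu /(uniq_split gu)[-> ->].
Qed.

(** This and the next two functions read only the local state, so that the automata can use them. *)
Definition current_phase (o : option know) :=
  if o is Some z then phase_of z.1 else ini S.
Definition todo p (o : option know) :=
  if o is Some z then drop (index z.1 (events_of (phase_of z.1) p)).+1 (events_of (phase_of z.1) p)
  else events_of (ini S) p.
Definition known_next (o : option know) := if o is Some z then z.2 else None.

Lemma drop_index (T : eqType) (e : T) t1 t2 : uniq (t1 ++ e :: t2) ->
  drop (index e (t1 ++ e :: t2)).+1 (t1 ++ e :: t2) = t2.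
Proof.
rewrite cat_uniq /= => /and3P[_ /norP[et1 _] _].
rewrite index_cat (negPf et1) /= eqxx addn0 -cat_rcons drop_size_cat //.
by rewrite size_rcons.
Qed.

(** The last event, even without its index, determines what is left of its phase, because the lists
    [events_of] have no duplicates. *)
Lemma lstate_spec s X p : ginv s X -> exists k,
  [/\ k <= size s, current_phase (lstate s (X p)) = nth (ini S) (ini S :: s) k,
    gevents 0 (ini S :: s) p =
      X p ++ map (pair k) (todo p (lstate s (X p))) ++ gevents k.+1 (drop k s) p
  & (k = 0 /\ X p = [::]) \/ exists l e, X p = rcons l (k, e)].
Proof.
move=> gi; have [Y] := g_pre gi p; case/lastP: (X p) => [|l [k e]].
  by exists 0; split=> //=; [rewrite drop0|left].
rewrite cat_rcons lstate_rcons => E; exists k.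
have [t1 [t2 [sqE lE YE [lt_k phe oe]]]] := gevents_next E.
split=> //; last by right; exists l, e.
rewrite E cat_rcons YE; congr (_ ++ _ :: map _ _ ++ _).
by rewrite /todo /= sqE drop_index // -sqE events_of_uniq.
Qed.

Definition last_opt (t : seq EV) :=
  if t is e :: t' then Some (last e t') else None.

Lemma last_opt_rcons t e : last_opt (rcons t e) = Some e.
Proof. by case: t => //= e' t; rewrite last_rcons. Qed.

Definition nu_last s k t := if last_opt t is Some e then nu s (k, e) else None.

(** The next event either continues the current phase or is the first one of [p] in a later phase;
    in the second case [p] has no event in the phases between. *)
Lemma state_next s X p k h Y : ginv s X ->
    gevents 0 (ini S :: s) p = X p ++ (k, h) :: Y ->
  exists t1 t2, [/\ events_of (phase_of h) p = t1 ++ h :: t2, owner h = p, k <= size s,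
      phase_of h = nth (ini S) (ini S :: s) k
    & (todo p (lstate s (X p)) = h :: t2
      /\ known_next (lstate s (X p)) = nu_last s k t1) \/
      [/\ t1 = [::], todo p (lstate s (X p)) = [::],
          X p = gevents 0 (take k (ini S :: s)) p
        & exists k', [/\ k' < k,
          current_phase (lstate s (X p)) = nth (ini S) (ini S :: s) k'
        & gevents k'.+1 (drop k' s) p = (k, h) :: Y]]].
Proof.
move=> gi E; have [t1 [t2 [sqE XE YE [lt_k phh oh]]]] := gevents_next E.
exists t1, t2; split=> //; have [k' [le_k' cE E' Xp]] := lstate_spec p gi.
move: E'; rewrite {1}E => /eqP; rewrite eqseq_cat // eqxx /= => /eqP.
case defR: (todo p (lstate s (X p))) => [|h' t'] /=.
  move=> E'; right.
  have lt_k'k: k' < k.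
    have: (k, h) \in gevents k'.+1 (drop k' s) p by rewrite -E' mem_head.
    by rewrite mem_gevents => /andP[].
  suff t10: t1 = [::] by split=> //; [rewrite XE t10 cats0|exists k'].
  case/lastP: t1 sqE XE => // t1 e sqE; rewrite map_rcons -rcons_cat => XE.
  case: Xp => [[_ X0]|[l [e' X1]]]; first by rewrite X0 in XE; case: (_ ++ _) XE.
  by move: XE; rewrite X1 => /rcons_inj[_ kE _]; rewrite kE ltnn in lt_k'k.
case=> kE hE _; left; rewrite -hE -kE in defR Xp *.
case: Xp => [[k0 X0]|[l [e X1]]].
  move: XE; rewrite X0 => /esym/eqP; rewrite -size_eq0 size_cat addn_eq0 size_map.
  case/andP=> _ /nilP t10; split; last by rewrite t10.
  by rewrite -defR X0 /= -/(ini S); move: phh; rewrite k0 /= => <-;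
    rewrite sqE t10.
case/lastP: t1 sqE XE => [|t1 e1] sqE.
  rewrite cats0 X1 => XE; have: (k, e) \in gevents 0 (take k (ini S :: s)) p.
    by rewrite -XE mem_rcons mem_head.
  by rewrite mem_gevents size_take lt_k add0n ltnn andbF.
rewrite map_rcons -rcons_cat X1 lstate_rcons => /rcons_inj[_ eE].
split; last by rewrite /nu_last last_opt_rcons eE.
move: defR; rewrite X1 lstate_rcons /todo /= eE.
have: e1 \in events_of (phase_of h) p by rewrite sqE mem_cat mem_rcons mem_head.
rewrite mem_events_of => /andP[/eqP-> _] <-; rewrite sqE cat_rcons drop_index //.
by rewrite -cat_rcons -sqE events_of_uniq.
Qed.

(** Apart from the decision, an event gets its information from its predecessor on the process or
    from the message it receives, and both are available locally. *)
Lemma informed_step h t1 t2 : events_of (phase_of h) (owner h) = t1 ++ h :: t2 ->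
    decision (phase_of h) <> Some h ->
  informed h = (if last_opt t1 is Some e then informed e else false) || (~~ esend h && informed (partner h)).
Proof.
move=> sqE dh; apply/idP/idP =>
  [/informed_inv[//|[s1 [e [s2 [sqE' ke]]]]|[-> ->]]|].
- have := events_of_uniq (phase_of h) (owner h); rewrite sqE => u.
  rewrite sqE -[RHS]cat_rcons in sqE'; have [-> _] := uniq_split u sqE'.
  by rewrite last_opt_rcons ke.
- by rewrite orbT.
case/orP=> [|/andP[sh kh]]; last first.
  by rewrite -(partnerK h); apply: informed_partner; rewrite // esend_partner.
case/lastP: t1 sqE => // t1 e; rewrite last_opt_rcons cat_rcons => sqE.
exact: informed_succ sqE.
Qed.

Lemma pending_mate Psi X p k h Y :
    (forall q, exists Z, gevents 0 Psi q = X q ++ Z) ->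
    (forall p q, size (rcvs p (X q)) <= size (snds q (X p))) ->
    gevents 0 Psi p = X p ++ (k, h) :: Y -> ~~ esend h ->
  let q := owner (partner h) in let n := size (rcvs q (X p)) in
  n < size (snds p (X q)) ->
  drop n (snds p (X q)) = (k, partner h) :: drop n.+1 (snds p (X q)) /\
  (k, partner h) \in X q.
Proof.
move=> pre cnt E rh q n lt_n; have [Yq Eq] := pre q.
have := pending_rcvs E Eq (cnt q p); rewrite {1}/rcvs /= rh eqxx /= -/n.
rewrite (drop_nth (0, h)) //= => /eqP; rewrite eqseq_cons => /andP[/eqP].
move/(congr1 (@gpartner)); rewrite gpartnerK => xE _; rewrite -xE; split=> //.
have: gpartner (k, h) \in snds p (X q) by rewrite xE mem_nth.
by rewrite mem_snds => /and3P[].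
Qed.

Definition updX X g := fun p => if p == owner g.2 then rcons (X p) g else X p.

Lemma ginv_informed s X p k h Y : ginv s X ->
    gevents 0 (ini S :: s) p = X p ++ (k, h) :: Y ->
    (~~ esend h -> (k, partner h) \in X (owner (partner h))) ->
    decision (phase_of h) <> Some h ->
  (informed h -> k < size s)
    /\ forall t1 t2, events_of (phase_of h) p = t1 ++ h :: t2 ->
  nu s (k, h) = let v := nu_last s k t1 in
    if v is Some _ then v else if esend h then None else nu s (k, partner h).
Proof.
move=> gi E rh dh; have [t1 [t2 [sqE XE YE [lt_k phh oh]]]] := gevents_next E.
split=> [|t1' t2' sqE'].
  move: (sqE); rewrite -oh => sqE'.
  rewrite (informed_step sqE' dh) => /orP[|/andP[/rh + kh]]; last first.
    by move/(g_informed gi); apply.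
  case/lastP: t1 sqE XE {sqE'} => // t1 e sqE XE; rewrite last_opt_rcons => ke.
  apply: (g_informed gi (p := p)) ke;
    by rewrite XE mem_cat map_rcons mem_rcons mem_head orbT.
move: (sqE'); rewrite -oh => sqE'';
  rewrite /nu /= (informed_step sqE'' dh) /nu_last /nu.
by case: (last_opt t1') => [e|] /=; case: (esend h) => //=; case: (informed e).
Qed.

(** By [g_decision] the decisions of all earlier phases have been executed, so a pending one belongs
    to the last phase known, and executing it may append a phase to [s]. *)
Lemma decision_last s X p k h Y : ginv s X ->
  gevents 0 (ini S :: s) p = X p ++ (k, h) :: Y ->
  decision (phase_of h) = Some h -> k = size s.
Proof.
move=> gi E; have [t1 [t2 [_ _ _ [lt_k phh oh]]]] := gevents_next E.
have kX: (k, h) \notin X p.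
  by have := gevents_uniq 0 (ini S :: s) p; rewrite E cat_uniq /= =>
    /and3P[_ /norP[]].
move=> dh; apply/eqP; rewrite eqn_leq -ltnS lt_k leqNgt; apply: contra kX.
by rewrite phh in dh; move/(g_decision gi)/(_ dh); rewrite oh.
Qed.

(** Only a decision lengthens [s], and the same step records this decision in [X]; this preserves
    [g_decision] and [g_informed]. *)
Lemma ginv_step s X p k h Y s' : ginv s X ->
    gevents 0 (ini S :: s) p = X p ++ (k, h) :: Y ->
    (~~ esend h
      -> size (rcvs (owner (partner h)) (X p)) < size (snds p (X (owner (partner h))))) ->
    (if decision (phase_of h) == Some h then exists2 y, s' = rcons s y & nxt (phase_of h) y
     else s' = s) ->
  ginv s' (updX X (k, h)).
Proof.
move=> gi E rh ds'; have [t1 [t2 [sqE XE YE [lt_k phh oh]]]] := gevents_next E.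
have kS := decision_last gi E.
have rhm: ~~ esend h -> (k, partner h) \in X (owner (partner h)).
  by move=> sh; have [_] := pending_mate (g_pre gi) (g_cnt gi) E sh (rh sh).
have [t s'E]: exists t, s' = s ++ t.
  by case: ifP ds' => _ => [[y -> _]|->]; [exists [:: y];
    rewrite cats1|exists [::]; rewrite cats0].
have upd_sub p' g : g \in X p' -> g \in updX X (k, h) p'.
  by rewrite /updX; case: ifP => // _; rewrite mem_rcons inE orbC => ->.
have upd_new: (k, h) \in updX X (k, h) (owner h).
  by rewrite /updX eqxx mem_rcons mem_head.
split.
- case: ifP ds' => [/eqP dh|_] => [[y -> hy]|->]; last exact: g_path gi.
  rewrite rcons_path (g_path gi) /=; move: hy; rewrite phh (kS dh).
  by rewrite -[nth _ _ _]/(nth (ini S) (ini S :: s) (size s)) nth_last.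
- move=> p'; rewrite s'E -cat_cons gevents_cat /updX -[(k, h).2]/h oh.
  case: eqP => [->|_]; first by rewrite E -cat_rcons -catA; eexists.
  by have [Y' ->] := g_pre gi p'; rewrite -catA; eexists.
- move=> p' q'; apply: leq_trans (_ : size (snds q' (X p')) <= _); last first.
    rewrite /updX; case: eqP => // _; rewrite /snds filter_rcons.
    by case: ifP => // _; rewrite size_rcons.
  rewrite {1}/updX -[(k, h).2]/h oh; case: eqP => [->|_]; last exact: (g_cnt gi).
  have le := g_cnt gi p' p; rewrite /rcvs filter_rcons /=.
  case: ifP => // /andP[sh /eqP pE]; rewrite size_rcons -pE.
  exact: rh.
- move=> k' d lt_k' dd; have [lt_k's|] := ltnP k' (size s).
    apply: upd_sub; apply: (g_decision gi) => //;
      rewrite -dd s'E -cat_cons nth_cat /=.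
    by rewrite ltnS (ltnW lt_k's).
  move=> le_k'; case: ifP ds' => [/eqP dh [y s'E' _]|_ s'E']; last first.
    by move: lt_k'; rewrite s'E' ltnNge le_k'.
  have k'E: k' = k by rewrite (kS dh); move: lt_k'; rewrite s'E' size_rcons; lia.
  move: dd; rewrite k'E s'E -cat_cons nth_cat lt_k -phh dh => -[<-].
  exact: upd_new.
move=> p' k' e; rewrite {1}/updX /= => + ke.
have old: (k', e) \in X p' -> k' < size s'.
  by move/(g_informed gi)/(_ ke) => lt; rewrite s'E size_cat ltn_addr.
case: eqP => // _; rewrite mem_rcons inE => /predU1P[[kE eE]|//]; subst k' e.
case: ifP ds' => [/eqP dh [y -> _]|/eqP dh ->].
  by rewrite size_rcons (kS dh).
by have [kk _] := ginv_informed gi E rhm dh; apply: kk.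
Qed.

(** Executed informed events have an index below [size s], and the entry they read is not affected
    by later choices. *)
Lemma nu_ext s X t p g : ginv s X -> g \in X p -> nu (s ++ t) g = nu s g.
Proof.
case: g => k e gi kX; rewrite /nu /=; case: ifP => // ke.
by rewrite nth_cat (g_informed gi kX ke).
Qed.

Lemma lstate_ext s X t p : ginv s X -> lstate (s ++ t) (X p) = lstate s (X p).
Proof.
move=> gi; case/lastP XE: (X p) => [//|l g]; rewrite !lstate_rcons.
by rewrite (nu_ext _ gi (p := p)) // XE mem_rcons mem_head.
Qed.

Lemma channel_ext s X t p q : ginv s X
  -> channel (s ++ t) X p q = channel s X p q.
Proof.
move=> gi; apply/eq_in_map => g /mem_drop; rewrite mem_filter => /andP[_ gX].
by rewrite /payload (nu_ext _ gi gX).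
Qed.

Definition pact s g : action P (C * know) :=
  if esend g.2 then Snd (owner g.2) (owner (partner g.2)) (payload s g)
  else Rcv (owner g.2) (owner (partner g.2)) (payload s (gpartner g)).

Definition act h : action P C :=
  if esend h then Snd (owner h) (owner (partner h)) (elabel h) else Rcv (owner h) (owner (partner h)) (elabel h).

Lemma pact_relabel s g : relabel fst (pact s g) = act g.2.
Proof. by rewrite /pact /act; case: ifP => //= _; rewrite elabel_partner. Qed.

Lemma channel_step s X p k h Y t : ginv s X ->
    gevents 0 (ini S :: s) p = X p ++ (k, h) :: Y ->
    (~~ esend h
      -> size (rcvs (owner (partner h)) (X p)) < size (snds p (X (owner (partner h))))) ->
  chan_step (pact (s ++ t) (k, h)) (channel s X) (channel (s ++ t) (updX X (k, h))).
Proof.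
move=> gi E rh; have [t1 [t2 [sqE XE YE [lt_k phh oh]]]] := gevents_next E.
rewrite /pact /=; case: ifP => sh /=; split.
- rewrite -(channel_ext t _ _ gi) /channel /updX /= eqxx -map_rcons -drop_rcons;
    last exact: (g_cnt gi).
  congr map; rewrite /snds filter_rcons /= sh eqxx /=; congr drop.
  by case: eqP => // _; rewrite /rcvs filter_rcons /= sh.
- move=> r q' neq; rewrite -(channel_ext t _ _ gi) /channel /updX /=; congr map.
  have ->: size (rcvs r (if q' == owner h then rcons (X q') (k, h) else X q')) = size (rcvs r (X q')).
    by case: eqP => // _; rewrite /rcvs filter_rcons /= sh.
  case: eqP => // rE; rewrite /snds filter_rcons /= sh; case: eqP => //= qE.
  by rewrite rE qE eqxx in neq.
- rewrite -(channel_ext t _ _ gi) /channel /updX /= eqxx oh.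
  have rh' := rh (negbT sh); have [-> _] :=
    pending_mate (g_pre gi) (g_cnt gi) E (negbT sh) rh'.
  rewrite /rcvs filter_rcons /= sh eqxx /= size_rcons;
    congr (_ :: map _ (drop _ _)).
  by case: eqP => // _; rewrite /snds filter_rcons /= sh.
move=> r q' neq; rewrite -(channel_ext t _ _ gi) /channel /updX /=; congr map.
have ->: snds q' (if r == owner h then rcons (X r) (k, h) else X r) = snds q' (X r).
  by case: eqP => // _; rewrite /snds filter_rcons /= sh.
case: eqP => // qE; rewrite /rcvs filter_rcons /= sh; case: eqP => //= rE.
by rewrite rE qE eqxx in neq.
Qed.

(** A promise is handed on from phase to phase until [p] takes part, so it describes the next event
    of [p] however far away it is. *)
Lemma promise_pending x t p j k h Y : path (@nxt _ _ S) x t -> x != ini S ->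
  gevents j t p = (k, h) :: Y -> promise x p = Some (esend h, owner (partner h)).
Proof.
elim: t x j => //= y t IH x j /andP[xy yt] xi; rewrite (promise_nxt _ xy xi).
by case: (events_of y p) => [|e s] /=; [apply: IH yt (nxt_ini xy)|case=> _ -> _].
Qed.

Lemma promise_none x t p j : path (@nxt _ _ S) x t -> x != ini S ->
  fin (last x t) -> gevents j t p = [::] -> promise x p = None.
Proof.
elim: t x j => [|y t IH] x j /=; first by move=> _ xi fx _; apply: promise_fin.
move=> /andP[xy yt] xi fx; rewrite (promise_nxt _ xy xi).
by case: (events_of y p) => [|e s] //=; apply: IH yt (nxt_ini xy) fx.
Qed.

Lemma active_beforeP s p k : path (@nxt _ _ S) (ini S) s -> k < size s ->
  active_before (nth (ini S) s k) p = (gevents 1 (take k s) p != [::]).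
Proof.
move=> sp; elim: k => [|k IH] lt_k.
  by rewrite take0 /=; case: s sp lt_k => //= y s /andP[/active_before_ini-> _].
have lt_k' := ltnW lt_k; rewrite (active_before_nxt _ (x := nth (ini S) s k)).
- rewrite IH // (take_nth (ini S)) // -cats1 gevents_cat /= cats0.
  by case: (gevents 1 _ p); case: (events_of _ p).
- by move/(pathP (ini S)): (sp) => /(_ k.+1 lt_k).
by move: sp => /(pathP (ini S))/(_ _ lt_k')/nxt_ini.
Qed.

End Ghost.

(** * The automata and their simulation by global histories *)

Section Machine.
Variables (P C : eqType) (S : phases P C).
Implicit Types (x y : phase S) (e h : pevent S) (p q r : P) (s f : seq (phase S)).
Implicit Types (X : P
  -> seq (gevent S)) (Y : seq (gevent S)) (o : option (know S)).

(* [v1] and [v2] are what the process and the message know about the next phase;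
   a decision is the only event that may add to this. *)
Definition nuok h (v1 v2 v : option (phase S)) :=
  if decision (phase_of h) == Some h then (if v is Some y then nxt (phase_of h) y else false)
  else v == if v1 is Some _ then v1 else v2.

(* The three cases: the next event of the current phase, the first event of a
   phase the process is informed of, and the first event of the opener. *)
Definition snd_trans p o (z : know S) :=
  let h := z.1 in
  [&& esend h, owner h == p &
   [|| (ohead (todo p o) == Some h) && nuok h (known_next o) None z.2
    , [&& todo p o == [::], known_next o == Some (phase_of h), ohead (events_of (phase_of h) p) == Some h
        & nuok h None None z.2]
    | [&& o == None, opener S == Some p, nxt (ini S) (phase_of h),
          ohead (events_of (phase_of h) p) == Some h & nuok h None None z.2]]].

(* In the second case the process may be unaware of the new phase: the promise,
   or after [ini] the flag, excludes messages that overtake its next event. *)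
Definition rcv_trans p o (d z : know S) :=
  let h := z.1 in
  [&& h == partner d.1, esend d.1, owner h == p &
   (ohead (todo p o) == Some h) && nuok h (known_next o) d.2 z.2 ||
   [&& todo p o == [::], ohead (events_of (phase_of h) p) == Some h,
       (if current_phase o == ini S then ~~ active_before (phase_of h) p
        else promise (current_phase o) p == Some (false, owner d.1))
     & nuok h None d.2 z.2]].

Definition transitions p : seq (option (know S) * action P (C * know S) * option (know S)) :=
  [seq (t.1, Snd p (owner (partner t.2.1)) (elabel t.2.1, t.2), Some t.2)
     | t <- enum {: option (know S) * know S} & snd_trans p t.1 t.2] ++
  [seq (t.1.1, Rcv p (owner t.1.2.1) (elabel t.1.2.1, t.1.2), Some t.2)
     | t <- enum {: option (know S) * know S * know S} & rcv_trans p t.1.1 t.1.2 t.2].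

(** In the initial phase there is no promise to consult. Testing the informed processes and the
    opener suffices: when the channels are empty, the least pending event is a send, and only these
    processes can begin the next phase with a send. *)
Definition accepts p o :=
  (todo p o == [::]) &&
  if current_phase o == ini S then
    if o is Some z then (if z.2 is Some y then events_of y p == [::] else true)
    else (opener S == Some p) ==>
           [exists y, [&& nxt (ini S) y, fin y & events_of y p == [::]]]
  else promise (current_phase o) p == None.

Fact transitions_alphabet p o a o' :
  (o, a, o') \in transitions p -> a \in [seq t.1.2 | t <- transitions p].
Proof. by move=> t; apply/mapP; exists (o, a, o'). Qed.

Definition process p :=
  Automaton None (accepts p) (@transitions_alphabet p).

Fact process_actor p a : a \in alphabet (process p) -> actor a = p.
Proof.
case/mapP => t; rewrite mem_cat => /orP[] /mapP[z _ ->] -> //.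
Qed.

Definition protocol := Cfm process_actor.

Lemma transitions_sndP p o p' q m o' : (o, Snd p' q m, o') \in transitions p ->
  exists z, [/\ p' = p, q = owner (partner z.1), m = (elabel z.1, z), o' = Some z & snd_trans p o z].
Proof.
rewrite mem_cat => /orP[] /mapP[[o1 z]]; rewrite mem_filter /= => /andP[t _] //.
by case=> -> -> -> -> ->; exists z.
Qed.

Lemma transitions_rcvP p o p' q m o' : (o, Rcv p' q m, o') \in transitions p ->
  exists d z, [/\ p' = p, q = owner d.1, m = (elabel d.1, d), o' = Some z & rcv_trans p o d z].
Proof.
rewrite mem_cat => /orP[] /mapP[[o1 z]]; rewrite mem_filter /= => /andP[t _] //.
by case=> -> -> -> -> ->; exists o1.2, z.
Qed.

Lemma transitions_snd p o z : snd_trans p o z ->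
  (o, Snd p (owner (partner z.1)) (elabel z.1, z), Some z) \in transitions p.
Proof.
move=> t; rewrite mem_cat; apply/orP; left; apply/mapP; exists (o, z) => //.
by rewrite mem_filter t mem_enum.
Qed.

Lemma transitions_rcv p o d z : rcv_trans p o d z ->
  (o, Rcv p (owner d.1) (elabel d.1, d), Some z) \in transitions p.
Proof.
move=> t; rewrite mem_cat; apply/orP; right; apply/mapP; exists (o, d, z) => //.
by rewrite mem_filter t mem_enum.
Qed.

(** The simulation relation: the whole configuration is a function of the decided phases and of the
    executed events. *)
Definition crel (c : config protocol) s X :=
  (forall p, local c p = lstate s (X p)) /\
  (forall p q, chan c p q = channel s X p q).

(* The phase chosen by the opener is appended before its first event. *)
Definition base s X p s0 := s0 = s \/
  [/\ s = [::], opener S = Some p, X p = [::]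
    & exists2 y, s0 = [:: y] & nxt (ini S) y].

Lemma base_ginv s X p s0 : base s X p s0 -> ginv s X -> ginv s0 X.
Proof.
case=> [->//|[-> vp X0 [y -> iy]]] gi.
have [_ di _] := opener_ini vp; split.
- by rewrite /= iy.
- move=> q; have [Y E] := g_pre gi q; exists (Y ++ gevents 1 [:: y] q).
  by rewrite catA -E -gevents_cat.
- exact: (g_cnt gi).
- by case=> //= d _; rewrite di.
by move=> q k e /(g_informed gi); rewrite /= => H /H.
Qed.

Lemma base_cat s X p s0 : base s X p s0 -> exists t, s0 = s ++ t.
Proof.
case=> [->|[-> _ _ [y -> _]]]; first by exists [::]; rewrite cats0.
by exists [:: y].
Qed.

Definition extends s s' h :=
  if decision (phase_of h) == Some h then exists2 y, s' = rcons s y & nxt (phase_of h) y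
  else s' = s.

Lemma extends_cat s s' h : extends s s' h -> exists t, s' = s ++ t.
Proof.
rewrite /extends; case: ifP => _ => [[y -> _]|->].
  by exists [:: y]; rewrite cats1.
by exists [::]; rewrite cats0.
Qed.

(** The list of phases ceases to be empty only by the first event of the opener: the initial phase
    has no decision if there is an opener. *)
Lemma opened_step s X p s0 s' k h Y : opened s X -> base s X p s0 -> ginv s0 X ->
  gevents 0 (ini S :: s0) p = X p ++ (k, h) :: Y ->
  extends s0 s' h -> opened s' (updX X (k, h)).
Proof.
move=> gv b gi E ex r vr s'_gt; have [t1 [t2 [_ _ _ [lt_k phh oh]]]] :=
  gevents_next E.
have [_ di _] := opener_ini vr.
rewrite /updX /= oh; case: (r =P p) => [_|rp]; first by case: (X r).
case: b => [s0E|[_ vp]]; last by move: rp; rewrite vr in vp; case: vp.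
apply: gv vr _; case: s s0E => // s0E; subst s0.
move: ex s'_gt; rewrite /extends; case: eqP => [dh|_ -> //].
have k0 := decision_last gi E dh; move: dh; rewrite phh k0 /= di //.
Qed.

Lemma nuok_ext s X p k h Y t1 t2 v : ginv s X ->
    gevents 0 (ini S :: s) p = X p ++ (k, h) :: Y ->
    (~~ esend h -> (k, partner h) \in X (owner (partner h))) ->
    events_of (phase_of h) p = t1 ++ h :: t2 ->
  nuok h (nu_last s k t1) (if esend h then None else nu s (k, partner h)) v ->
  exists2 s', extends s s' h & v = nu s' (k, h).
Proof.
move=> gi E rh sqE; rewrite /nuok /extends; case: eqP => [dh|dh /eqP ->].
  have kE := decision_last gi E dh; have [_ kh] := informed_decision dh.
  case: v => // y hy; exists (rcons s y); first by exists y.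
  by rewrite /nu /= kh nth_rcons kE ltnn eqxx.
by exists s => //; have [_ /(_ _ _ sqE)->] := ginv_informed gi E rh dh.
Qed.

Lemma nuok_nu s X p k h Y t1 t2 s' : ginv s X ->
    gevents 0 (ini S :: s) p = X p ++ (k, h) :: Y ->
    (~~ esend h -> (k, partner h) \in X (owner (partner h))) ->
    events_of (phase_of h) p = t1 ++ h :: t2 -> extends s s' h ->
  nuok h (nu_last s k t1) (if esend h then None else nu s (k, partner h)) (nu s' (k, h)).
Proof.
move=> gi E rh sqE; rewrite /nuok /extends; case: eqP => [dh [y -> hy]|dh ->].
  have kE := decision_last gi E dh; have [_ kh] := informed_decision dh.
  by rewrite /nu /= kh nth_rcons kE ltnn eqxx.
by have [_ /(_ _ _ sqE)->] := ginv_informed gi E rh dh.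
Qed.

(** The head of the channel is the message that the first pending receive of [p] from [q] is waiting
    for; this recovers the phase index, which messages do not carry. *)
Lemma head_pending s X p q e (v : option (phase S)) ms Y : ginv s X ->
    gevents 0 (ini S :: s) p = X p ++ Y
      -> channel s X q p = (elabel e, (e, v)) :: ms ->
  exists k R, [/\ v = nu s (k, e), rcvs q Y = (k, partner e) :: R, (k, e) \in X q
    & size (rcvs q (X p)) < size (snds p (X q))].
Proof.
move=> gi E; have [Yq Eq] := g_pre gi q.
have := pending_rcvs E Eq (g_cnt gi q p); rewrite /channel.
set n := size _; case defD: (drop n _) => [|[k e'] D] //= RE [_ eE <- _].
subst e'; exists k; eexists; split=> //; first exact: RE.
  have: (k, e) \in drop n (snds p (X q)) by rewrite defD mem_head.
  by move/mem_drop; rewrite mem_snds => /and3P[].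
rewrite ltnNge; apply/negP => /drop_oversize; by rewrite defD.
Qed.

(** The crux of soundness: any transition enabled by the local state and the head of a channel
    executes the next event of its process, along [s] or along the phase just chosen by the
    opener. *)
Lemma trans_next s X p a o' :
    ginv s X -> opened s X -> (lstate s (X p), a, o') \in transitions p ->
    (forall q m, a = Rcv p q m -> exists ms, channel s X q p = m :: ms) ->
  exists s0 k h Y t1 t2 v,
  [/\ base s X p s0, gevents 0 (ini S :: s0) p = X p ++ (k, h) :: Y,
      o' = Some (h, v) /\
      (~~ esend h
        -> size (rcvs (owner (partner h)) (X p)) < size (snds p (X (owner (partner h))))),
      events_of (phase_of h) p = t1 ++ h :: t2 /\
      nuok h (nu_last s0 k t1) (if esend h then None else nu s0 (k, partner h)) v
    & a = if esend h then Snd p (owner (partner h)) (elabel h, (h, v))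
          else Rcv p (owner (partner h)) (payload s0 (k, partner h))].
Proof.
move=> gi gv tr rc; have [k' [le_k' cE E Xp]] := lstate_spec p gi.
case: a tr rc => p' q m tr rc.
  have [[h v] [-> -> -> -> /=]] := transitions_sndP tr; rewrite /snd_trans /=.
  case/and3P=> sh /eqP oh /or3P[/andP[]|/and4P[]|/and5P[]].
  - case defR: (todo p _) E => [|h' R] //= E /eqP[hE]; subst h' => nh.
    have [t1 [t2 [sqE _ _ _ kn1]]] := state_next gi E.
    exists s, k', h; eexists; exists t1, t2, v; split;
      [by left|exact: E|by rewrite sh| |by rewrite sh].
    split=> //; rewrite sh; case: kn1 => [[_ <-]|[_]] //.
    by rewrite defR.
  - move=> /eqP defR /eqP kE hd nh; rewrite defR /= in E.
    case: Xp => [[_ X0]|[l [e X1]]]; first by rewrite X0 in kE.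
    rewrite X1 lstate_rcons /known_next /nu /= in kE; move: kE; case: ifP =>
      // ke [phE].
    have lt_k': k' < size s.
      by apply: (g_informed gi (p := p)) ke; rewrite X1 mem_rcons mem_head.
    move: E hd; rewrite (drop_nth (ini S)) //= phE.
    case defQ: (events_of (phase_of h) p) => [|h' Q] //= E /eqP[hE]; subst h'.
    exists s, k'.+1, h; eexists; exists [::], Q, v; split;
      [by left|exact: E|by rewrite sh| |by rewrite sh].
    by rewrite sh.
  - move=> /eqP lE /eqP vp ih hd nh; have [i0 _ _] := opener_ini vp.
    have X0: X p = [::] by case: (X p) lE.
    have s0: s = [::].
      by case: (s) gv => [//|y s'] /(_ _ vp); rewrite X0 => /(_ isT).
    case defQ: (events_of (phase_of h) p) hd => [|h' Q] //= /eqP[hE]; subst h'.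
    exists [:: phase_of h], 1, h, (map (pair 1) Q), [::], Q, v;
      rewrite /= i0 X0 defQ cats0 sh.
    split=> //; right; split=> //; by exists (phase_of h).
have [[e w] [[h v] [pE qE mE -> /=]]] := transitions_rcvP tr;
  rewrite /rcv_trans /=.
subst p' q m; have [ms chE] := rc _ _ erefl.
case/and4P=> /eqP hE se /eqP oh cond.
have sh: esend h = false by rewrite hE esend_partner se.
have meE: partner h = e by rewrite hE partnerK.
have [k [R [wE RE kX lt_n]]] := head_pending gi E chE.
rewrite /= in chE wE RE kX lt_n *.
suff [Y [t1 [t2 [E1 sqE nh]]]]: exists Y t1 t2,
  [/\ gevents 0 (ini S :: s) p = X p ++ (k, h) :: Y,
    events_of (phase_of h) p = t1 ++ h :: t2 & nuok h (nu_last s k t1) (nu s (k, partner h)) v].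
  exists s, k, h, Y, t1, t2, v; rewrite sh meE; split=> //; first by left.
    by split=> //; rewrite -meE.
  by rewrite /payload /= wE.
case/orP: cond => [/andP[]|/and4P[]].
  case defR: (todo p _) E RE => [|h' Rm] //= E + /eqP[hE'] nh; subst h'.
  rewrite /rcvs /= sh meE eqxx /= => -[kE _]; subst k'.
  have [t1 [t2 [sqE _ _ _ kn1]]] := state_next gi E.
  exists (map (pair k) Rm ++ gevents k.+1 (drop k s) p), t1, t2; split=> //.
  by case: kn1 => [[_ <-]|[_]]; rewrite ?defR // -wE.
move=> /eqP defR hd flg nh; rewrite defR /= in E RE.
(* The message may belong to a phase of which [p] is unaware. It remains to show that [p] has no
   earlier pending event. *)
suff [Y YE]: exists Y, gevents k'.+1 (drop k' s) p = (k, h) :: Y.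
  rewrite YE in E; have [t1 [t2 [sqE _ _ _ kn1]]] := state_next gi E.
  exists Y, t1, t2; split=> //; case: kn1 => [[]|[-> _ _ _]];
    first by rewrite defR.
  by rewrite /nu_last /= ?meE -wE.
case: eqP flg => [ci flg|ci /eqP pE]; last first.
  (* By the promise, the next event of [p] is a receive from the sender of this message; it is then
     the first pending receive from there, which is [h]. *)
  case YE: (gevents _ _ p) RE => [|[k1 h1] Y] // RE.
  have sp := g_path gi; rewrite -(cat_take_drop k' s) cat_path in sp.
  have lastE: last (ini S) (take k' s) = current_phase (lstate s (X p)).
    by rewrite cE (last_nth (ini S)) size_takel // -[in RHS](cat_take_drop k' s) -cat_cons nth_cat /= size_takel // ltnSn.
  case/andP: sp => _; rewrite lastE => sp.
  have := promise_pending sp (introN eqP ci) YE; rewrite pE => -[/esym sh1 oh1].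
  exists Y; move: RE; rewrite /rcvs /= sh1 /= -oh1 eqxx.
  by rewrite hE => -[-> -> _].
(* After the initial phase, the flag says that no phase strictly between the initial one and that of
   [h] has an event of [p]. *)
rewrite ci in cE; have k0 := ini_first (g_path gi) le_k' (esym cE); subst k'.
rewrite drop0 in RE E *.
have: (k, h) \in gevents 1 s p.
  have: (k, partner e) \in rcvs (owner e) (gevents 1 s p) by rewrite RE mem_head.
  by rewrite mem_filter -hE => /andP[].
rewrite mem_gevents => /and4P[k_gt lt_k /eqP phE _].
case: k k_gt lt_k phE {RE wE kX} => // k _; rewrite add1n !subSS subn0 ltnS =>
  lt_k phE.
move: flg; rewrite phE (active_beforeP _ (g_path gi) lt_k) negbK => /eqP g0.
rewrite -{1}(cat_take_drop k s) gevents_cat g0 size_takel; last exact: ltnW.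
rewrite (drop_nth (ini S)) //= -phE add1n.
by case: (events_of (phase_of h) p) hd => //= h' Q /eqP[->]; eexists.
Qed.

Lemma chan_step_ext (a : action P (C * know S)) b b' b1 b1' :
    (forall p q, b p q = b' p q) -> (forall p q, b1 p q = b1' p q) ->
  chan_step a b b1 -> chan_step a b' b1'.
Proof.
move=> bE b1E; case: a => p q m /= [E F]; split; rewrite -?bE -?b1E // => r s rs.
  by rewrite -bE -b1E; apply: F.
by rewrite -bE -b1E; apply: F.
Qed.

Lemma act_actor h : actor (act h) = owner h.
Proof. by rewrite /act; case: ifP. Qed.

Lemma pact_actor s (g : gevent S) : actor (pact s g) = owner g.2.
Proof. by rewrite /pact; case: ifP. Qed.

Lemma step_back (c c' : config protocol) s X a : crel c s X -> ginv s X
  -> opened s X ->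
  step c a c' ->
  exists s' k h, [/\ ginv s' (updX X (k, h)), opened s' (updX X (k, h)),
    crel c' s' (updX X (k, h)) & relabel fst a = act h].
Proof.
move=> [lE cE] gi gv [tr loc ch]; set p := actor a in tr loc.
rewrite lE in tr.
have [|s0 [k [h [Y [t1 [t2 [v [b E [o'E rh] [sqE nh] aE]]]]]]]] :=
  trans_next gi gv tr.
  move=> q m aE; rewrite aE /= in ch; exists (chan c' q p).
  by have [<- _] := ch; rewrite -cE /p aE.
have gi0 := base_ginv b gi.
have [_ [_ [_ _ _ [_ _ oh]]]] := gevents_next E.
have rhm: ~~ esend h -> (k, partner h) \in X (owner (partner h)).
  by move=> sh; have [_] := pending_mate (g_pre gi0) (g_cnt gi0) E sh (rh sh).
have [s' ex vE] := nuok_ext gi0 E rhm sqE nh.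
have [t s'E] := extends_cat ex; have [t' s0E] := base_cat b.
have aE': a = pact s' (k, h).
  rewrite aE /pact /= oh; case: ifP => sh; first by rewrite vE.
  by rewrite /payload s'E (nu_ext _ gi0 (p := owner (partner h))) // rhm ?sh.
have gi' := ginv_step gi0 E rh ex.
exists s', k, h; split=> //; first exact: opened_step gv b gi0 E ex; last first.
  by rewrite aE' pact_relabel.
split=> [r|r q].
  rewrite /updX /= oh; case: eqP => [->|/eqP nr];
    first by rewrite o'E vE lstate_rcons.
  by rewrite loc // lE s'E s0E -catA lstate_ext.
have := channel_step t gi0 E rh; rewrite -s'E -aE' => ch'.
(* The action determines the new channel contents, so it is enough that the history produces the
   same action. *)
apply: (chan_step_inj ch); apply: chan_step_ext ch' => // p1 q1.
by rewrite cE s0E channel_ext.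
Qed.

(** No message announces a phase to a process that begins it with a send. By [nxt_snd] such a
    process is informed by its last event in the preceding phase, or it is the opener and has no
    event behind it. *)
Lemma first_send f (l : seq (gevent S)) p k h Y t : path (@nxt _ _ S) (ini S) f ->
    gevents 0 (ini S :: f) p = l ++ (k.+1, h) :: Y ->
    events_of (phase_of h) p = h :: t -> esend h ->
  (exists l' g, l = rcons l' (k, g) /\ informed g) \/
  [/\ k = 0, opener S = Some p, l = [::] & nxt (ini S) (phase_of h)].
Proof.
move=> fp E sqE sh; have [t1 [t2 [sqE' lE _ [lt_k phh oh]]]] := gevents_next E.
have t10 : t1 = [::].
  have := events_of_uniq (phase_of h) p; rewrite sqE' => u.
  by have [] := @uniq_split _ h t1 t2 [::] t u; rewrite -?sqE'.
have lt_kf : k < size f := lt_k.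
have edge_k: nxt (nth (ini S) (ini S :: f) k) (phase_of h).
  by rewrite phh /=; move/(pathP (ini S)): fp; apply.
have {}lE : l = gevents 0 (take k (ini S :: f)) p ++
    map (pair k) (events_of (nth (ini S) (ini S :: f) k) p).
  rewrite lE t10 [map _ [::]]/= cats0 (take_nth (ini S)); last by rewrite ltnW.
  rewrite -cats1 gevents_cat size_takel; last by rewrite ltnW // ltnW.
  by rewrite [gevents (0 + k) _ _]/= cats0.
case: (nxt_snd edge_k sqE sh) => [[s1 [g [sqk kg]]]|[ii vp]].
  by left; rewrite lE sqk map_rcons -rcons_cat; eexists; exists g.
have k0: k = 0 by apply: ini_first fp (ltnW lt_kf) ii.
right; split=> //; last by rewrite -ii.
by have [i0 _ _] := opener_ini vp; rewrite lE ii i0 k0.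
Qed.

Lemma trans_fwd s s' X p k h Y : ginv s X ->
    gevents 0 (ini S :: s) p = X p ++ (k, h) :: Y ->
    (~~ esend h -> (k, partner h) \in X (owner (partner h))) -> extends s s' h ->
  (lstate s (X p), pact s' (k, h), Some (h, nu s' (k, h))) \in transitions p.
Proof.
move=> gi E rh ex; have [t1 [t2 [sqE oh le_k phh st]]] := state_next gi E.
have [t s'E] := extends_cat ex; have nh := nuok_nu gi E rh sqE ex.
rewrite /pact /=; case: ifP nh => sh nh.
  rewrite oh; apply: (transitions_snd (z := (h, nu s' (k, h)))).
  rewrite /snd_trans /= sh oh eqxx /=.
  case: st => [[-> ->]|[t10 -> XE [k' [lt_k' cE _]]]];
    first by rewrite /= eqxx nh.
  rewrite t10 in sqE nh; rewrite sqE /= !eqxx /=; apply/orP.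
  case: k {rh ex s'E XE} E le_k phh nh lt_k' => // k E le_k phh nh _.
  have [[l [g [XE kg]]]|[_ vp X0 ih]] := first_send (g_path gi) E sqE sh.
    by left; rewrite XE lstate_rcons /known_next /nu /= kg phh /= eqxx nh.
  by right; rewrite vp eqxx ih nh X0.
have sh' := negbT sh.
have -> : payload s' (gpartner (k, h)) = (elabel (partner h), (partner h, nu s (k, partner h))).
  by rewrite /payload s'E (nu_ext _ gi (rh sh')).
rewrite oh.
apply: (transitions_rcv (d := (partner h, nu s (k, partner h))) (z :=
  (h, nu s' (k, h)))).
rewrite /rcv_trans /= partnerK esend_partner sh oh !eqxx /=.
case: st => [[-> ->]|[t10 -> XE [k' [lt_k' cE YE]]]]; first by rewrite /= eqxx nh.
rewrite t10 in sqE nh; rewrite sqE /= !eqxx /= nh andbT.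
case: eqP => [ci|ci].
  rewrite ci in cE; have le_k' : k' <= size s by apply: leq_trans le_k;
    exact: ltnW.
  have k0 := ini_first (g_path gi) le_k' (esym cE); subst k'.
  case: k {rh E ex s'E nh} le_k phh XE lt_k' YE => // k le_k phh XE _.
  rewrite drop0 => YE; rewrite phh (active_beforeP _ (g_path gi)) // negbK.
  move: YE; rewrite -{1}(cat_take_drop k s) gevents_cat.
  case gE: (gevents 1 (take k s) p) => [//|[k1 h1] Z] [kE _].
  have: (k1, h1) \in gevents 1 (take k s) p by rewrite gE mem_head.
  by rewrite mem_gevents kE size_takel ?(ltnW le_k) // add1n ltnn !andbF.
have sp := g_path gi; rewrite -(cat_take_drop k' s) cat_path in sp.
have le_k' : k' <= size s by apply: leq_trans le_k; exact: ltnW.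
have lastE: last (ini S) (take k' s) = current_phase (lstate s (X p)).
  by rewrite cE (last_nth (ini S)) size_takel // -[in RHS](cat_take_drop k' s) -cat_cons nth_cat /= size_takel // ltnSn.
case/andP: sp => _; rewrite lastE => sp.
by rewrite (promise_pending sp (introN eqP ci) YE) (negbTE sh').
Qed.

Lemma gevents_prefix s X p k h Y t : ginv s X -> k <= size s ->
    gevents 0 (ini S :: s ++ t) p = X p ++ (k, h) :: Y ->
  exists Y', gevents 0 (ini S :: s) p = X p ++ (k, h) :: Y'.
Proof.
move=> gi le_k; have [Z EZ] := g_pre gi p; rewrite -cat_cons gevents_cat EZ -catA.
move/eqP; rewrite eqseq_cat // eqxx /= => /eqP; case: Z EZ => [|z Z] EZ /=.
  move=> E; have: (k, h) \in gevents (0 + size (ini S :: s)) t p by rewrite E mem_head.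
  by rewrite mem_gevents /= => /andP[]; rewrite add0n ltnNge le_k.
by case=> <- _; exists Z.
Qed.

Lemma prefix_pre s X f p : ginv s X -> prefix s f ->
  exists Y, gevents 0 (ini S :: f) p = X p ++ Y.
Proof.
move=> gi /prefixP[t ->]; have [Y E] := g_pre gi p.
by rewrite -cat_cons gevents_cat E -catA; eexists.
Qed.

(** An enabled event of the full run [f] lies in a phase already decided: its predecessor in the
    phase, its send, or an informed event of the preceding phase has been executed. The only
    exception is the first event of the opener. *)
Lemma locate s X p k h Y f : ginv s X -> opened s X -> prefix s f ->
    path (@nxt _ _ S) (ini S) f ->
    gevents 0 (ini S :: f) p = X p ++ (k, h) :: Y ->
    (~~ esend h
      -> size (rcvs (owner (partner h)) (X p)) < size (snds p (X (owner (partner h))))) ->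
  exists s0, [/\ base s X p s0, prefix s0 f & k <= size s0].
Proof.
move=> gi gv sf fp E rh; have [t1 [t2 [sqE XE _ [lt_k phh oh]]]] :=
  gevents_next E.
have inX k' e q : (k', e) \in X q -> k' <= size s.
  have [Z EZ] := g_pre gi q => kX.
  have: (k', e) \in gevents 0 (ini S :: s) q by rewrite EZ mem_cat kX.
  by rewrite mem_gevents => /and3P[_].
have [le_k|lt_s] := leqP k (size s); first by exists s; split=> //; left.
case: k lt_s E XE phh lt_k => // k lt_s E XE phh lt_k.
case/lastP: t1 sqE XE => [|t1 e] sqE XE; last first.
  have /inX: (k.+1, e) \in X p by rewrite XE map_rcons mem_cat mem_rcons mem_head orbT.
  by lia.
have [shE|shE] := boolP (esend h); last first.
  have [_ /inX] := pending_mate (fun q =>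
    prefix_pre q gi sf) (g_cnt gi) E shE (rh shE).
  by lia.
have [[l [g [X1 kg]]]|[k0 vp X0 ih]] := first_send fp E sqE shE.
  have kX: (k, g) \in X p by rewrite X1 mem_rcons mem_head.
  by have := g_informed gi kX kg; rewrite ltnNge -ltnS lt_s.
subst k; have s0: s = [::] by case: (s) lt_s => // ? ? /=; lia.
exists [:: phase_of h]; split=> //; first by right; split=> //;
  exists (phase_of h).
by case: (f) phh lt_k {sf fp E XE} => //= y f' ->; rewrite eqxx prefix0s.
Qed.

Lemma step_fwd (c : config protocol) s X p k h Y f :
    crel c s X -> ginv s X -> opened s X -> prefix s f ->
    path (@nxt _ _ S) (ini S) f -> fin (last (ini S) f) ->
    gevents 0 (ini S :: f) p = X p ++ (k, h) :: Y ->
    (~~ esend h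
      -> size (rcvs (owner (partner h)) (X p)) < size (snds p (X (owner (partner h))))) ->
  exists s' a c', [/\ step c a c', relabel fst a = act h,
    crel c' s' (updX X (k, h)), ginv s' (updX X (k, h))
    & opened s' (updX X (k, h)) /\ prefix s' f].
Proof.
move=> [lE cE] gi gv sf fp ff E rh.
have [s0 [b /prefixP[u fE] le_k]] := locate gi gv sf fp E rh; subst f.
have gi0 := base_ginv b gi; have [Y' E'] := gevents_prefix gi0 le_k E.
have [_ [_ [_ _ _ [_ phh oh]]]] := gevents_next E'.
(* A decision is taken in favour of the next phase of [f], which exists because final phases have no
   decision. *)
have [s' ex s'f]: exists2 s', extends s0 s' h & prefix s' (s0 ++ u).
  rewrite /extends; case: eqP => [dh|_]; last by exists s0;
    rewrite ?prefix_prefix.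
  have kE := decision_last gi0 E' dh.
  have lE0: phase_of h = last (ini S) s0 by rewrite phh kE (last_nth (ini S)).
  case: u {sf E} fp ff => [|y u].
    by rewrite cats0 -lE0 => _ /fin_decision; rewrite dh.
  rewrite cat_path -lE0 /= => /and3P[_ hy _] _; exists (rcons s0 y); last first.
    by rewrite -cat_rcons prefix_prefix.
  by exists y.
have rhm: ~~ esend h -> (k, partner h) \in X (owner (partner h)).
  by move=> sh; have [_] := pending_mate (g_pre gi0) (g_cnt gi0) E' sh (rh sh).
have [t s'E] := extends_cat ex; have [t' s0E] := base_cat b.
set X' := updX X (k, h); pose a := pact s' (k, h).
have aE: actor a = p by rewrite pact_actor.
exists s', a, (@Config _ _ protocol (fun q => lstate s' (X' q)) (channel s' X')).
split; [|exact: pact_relabel|by []|exact: ginv_step E' rh ex|]; last first.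
  by split=> //; apply: opened_step gv b gi0 E' ex.
split.
- rewrite lE /= -[is_true _]/(is_true ((lstate s (X (actor a)), a, lstate s' (X' (actor a))) \in transitions (actor a))).
  rewrite aE /X' /updX /= oh eqxx lstate_rcons /=.
  by have := trans_fwd gi0 E' rhm ex; rewrite s0E lstate_ext.
- move=> r; rewrite aE lE /= /X' /updX /= oh => /negPf->.
  by rewrite s'E s0E -catA lstate_ext.
have H := channel_step t gi0 E' rh; rewrite -s'E in H.
apply: chan_step_ext H => // p1 q1.
by rewrite cE s0E channel_ext.
Qed.

(** * Whole runs: words, progress and acceptance *)

Definition tied (w : seq (action P C)) X :=
  (forall p, proj w p = map (fun g => act g.2) (X p)) /\ causal w.

Lemma tied_count w s X : ginv s X ->
    (forall p, proj w p = map (fun g => act g.2) (X p)) -> forall p q,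
  count (is_rcv q p) w = size (rcvs p (X q)) /\
  count (is_snd p q) w = size (snds q (X p)).
Proof.
move=> gi wX p q; have oX r g : g \in X r -> owner g.2 = r.
  case: g => k e kX; have [Z E] := g_pre gi r.
  have: (k, e) \in gevents 0 (ini S :: s) r by rewrite E mem_cat kX.
  by rewrite mem_gevents => /and4P[_ _ _ /eqP].
split.
  have -> : count (is_rcv q p) w = count (is_rcv q p) (proj w q).
    rewrite count_filter; apply: eq_count => -[] //= q' p' _.
    by case: (q' == q) => //=; rewrite andbT.
  rewrite wX count_map -size_filter; congr size; apply: eq_in_filter => g gX.
  rewrite /= /act; case: ifP => //= _; by rewrite (oX _ _ gX) eqxx.
have -> : count (is_snd p q) w = count (is_snd p q) (proj w p).
  rewrite count_filter; apply: eq_count => -[] //= q' p' _.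
  by case: (q' == p) => //=; rewrite andbT.
rewrite wX count_map -size_filter; congr size; apply: eq_in_filter => g gX.
rewrite /= /act; case: ifP => //= _; by rewrite (oX _ _ gX) eqxx.
Qed.

Lemma tied_step w s X k h : tied w X -> ginv s (updX X (k, h)) ->
  tied (rcons w (act h)) (updX X (k, h)).
Proof.
move=> [wX wc] gi; have wX' p : proj (rcons w (act h)) p =
    map (fun g => act g.2) (updX X (k, h) p).
  rewrite /proj filter_rcons act_actor /updX /= eq_sym.
  by case: eqP => _; rewrite ?map_rcons -/(proj w p) wX.
split=> // n p q; have [le_n|lt_n] := leqP n (size w).
  by rewrite -cats1 takel_cat.
rewrite take_oversize ?size_rcons //.
by have [-> ->] := tied_count gi wX' p q; apply: g_cnt gi _ _.
Qed.

Lemma run_back v (c c' : config protocol) s X w :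
    crel c s X -> ginv s X -> opened s X -> tied w X -> exec c v c' ->
  exists s' X', [/\ crel c' s' X', ginv s' X', opened s' X'
    & tied (w ++ map (relabel fst) v) X'].
Proof.
elim: v c s X w => [|a v IHv] c s X w cr gi gv wX /=.
  by move=> <-; exists s, X; rewrite cats0.
case=> d [/(step_back cr gi gv)[s' [k [h [gi' gv' cr' ->]]]]].
by rewrite -cat_rcons; apply: IHv cr' gi' gv' (tied_step wX gi').
Qed.

Lemma run_fwd f w2 : path (@nxt _ _ S) (ini S) f -> fin (last (ini S) f) ->
  forall w1 (c : config protocol) s X,
    crel c s X -> ginv s X -> opened s X -> prefix s f -> tied w1 X ->
    (forall p, proj (w1 ++ w2) p = map (fun g =>
      act g.2) (gevents 0 (ini S :: f) p)) ->
    causal (w1 ++ w2) ->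
  exists v c' s' X', [/\ exec c v c', map (relabel fst) v = w2, crel c' s' X',
    ginv s' X' & [/\ opened s' X', prefix s' f & tied (w1 ++ w2) X']].
Proof.
move=> fp ff; elim: w2 => [|a w2 IHw] w1 c s X cr gi gv sf wX wf wc.
  by exists [::], c, s, X; rewrite cats0.
have [Y E] := prefix_pre (actor a) gi sf.
have := wf (actor a); rewrite E map_cat -(proj1 wX) /proj filter_cat /= eqxx.
move/eqP; rewrite eqseq_cat // eqxx /=; case: Y E => [//|[k h] Y] E.
rewrite /= eqseq_cons => /andP[/eqP aE _].
have [_ [_ [_ _ _ [_ phh oh]]]] := gevents_next E.
(* Causality of the prefix that ends with this receive puts the message into the channel. *)
have rh: ~~ esend h -> size (rcvs (owner (partner h)) (X (actor a))) <
    size (snds (actor a) (X (owner (partner h)))).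
  move=> sh; have := wc (size w1).+1 (owner (partner h)) (actor a).
  rewrite -cat_rcons take_size_cat ?size_rcons // -cats1 !count_cat.
  have [-> ->] := tied_count gi (proj1 wX) (owner (partner h)) (actor a).
  have r1: is_rcv (actor a) (owner (partner h)) a.
    by rewrite -oh aE /act (negPf sh) /= !eqxx.
  have r0: is_snd (owner (partner h)) (actor a) a = false.
    by rewrite -oh aE /act (negPf sh).
  by rewrite /= r1 r0 !addn0 addn1.
have [s' [b [d [st bE cr' gi' [gv' sf']]]]] := step_fwd cr gi gv sf fp ff E rh.
have wX' := tied_step wX gi'; rewrite -aE in wX'.
rewrite -cat_rcons in wf wc.
have [v [c' [s2 [X2 [ev vE cr2 gi2 [gv2 sf2 wX2]]]]]] :=
  IHw _ _ _ _ cr' gi' gv' sf' wX' wf wc.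
exists (b :: v), c', s2, X2; split=> //; first by exists d.
  by rewrite /= vE bE -aE.
by rewrite -cat_rcons.
Qed.

(** Progress: a pending event of least [grank] is enabled, since its predecessors on the process
    and, for a receive, its send have smaller rank. *)
Lemma min_pending s X f : ginv s X -> prefix s f ->
  (forall p, X p = gevents 0 (ini S :: f) p) \/
  exists p k h Y, [/\ gevents 0 (ini S :: f) p = X p ++ (k, h) :: Y,
    ~~ esend h
      -> size (rcvs (owner (partner h)) (X p)) < size (snds p (X (owner (partner h))))
  & forall q g, g \in gevents 0 (ini S :: f) q -> g \notin X q ->
      grank (k, h) <= grank g].
Proof.
move=> gi sf; pose Psi := ini S :: f.
(* [P] need not be finite, so the candidates are taken from all pairs of an index and an event. *)
pose pend :=
  [seq g <- [seq (k, e) | k <- iota 0 (size Psi), e <- enum (pevent S)] |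
  (g \in gevents 0 Psi (owner g.2)) && (g \notin X (owner g.2))] : seq (gevent S).
have pendE q g : g \in gevents 0 Psi q -> g \notin X q -> g \in pend.
  case: g => k e gk kX; have: (k, e) \in gevents 0 Psi q by [].
  rewrite mem_gevents => /and4P[_ lt_k _ /eqP oe]; rewrite mem_filter.
  apply/andP; split; first by rewrite /= oe gk kX.
  by apply: allpairs_f; rewrite ?mem_enum // mem_iota.
have pre q : exists Y, gevents 0 Psi q = X q ++ Y by apply: prefix_pre gi sf.
have notX q g Y Z : gevents 0 Psi q = X q ++ Y ++ g :: Z -> g \notin X q.
  move=> E; have := gevents_uniq 0 Psi q; rewrite E cat_uniq =>
    /and3P[_ /hasPn + _].
  by apply; rewrite mem_cat mem_head orbT.
have [p0|/(ex_min_seq (@grank _ _ S))[[k h]]] := eqVneq pend [::].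
  left=> p; have [[|g Y] E] := pre p; first by rewrite -/Psi E cats0.
  have: g \in pend.
    by apply: (pendE p) (notX p g [::] Y E); rewrite E mem_cat mem_head orbT.
  by rewrite p0.
rewrite mem_filter => /andP[/andP[kg0 kX0] _] kmin; right; pose p := owner h.
have kg : (k, h) \in gevents 0 Psi p := kg0; have kX : (k, h) \notin X p := kX0.
have [Y E] := pre p.
have kminE q g : g \in gevents 0 Psi q -> g \notin X q -> grank (k, h) <= grank g.
  by move=> gq gX; apply: kmin; apply: pendE gX.
exists p, k, h.
have: (k, h) \in Y by move: kg; rewrite E mem_cat (negPf kX).
case: Y E => // g Y E; rewrite inE => /predU1P[gE|kY]; last first.
  have gX: g \notin X p by apply: (notX p g [::] Y E).
  have := kminE p g; rewrite {1}E mem_cat mem_head orbT => /(_ isT gX).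
  have := gevents_grank 0 Psi p; rewrite E pairwise_cat /= =>
    /and4P[_ _ /allP/(_ _ kY)].
  by rewrite ltnNge => /negPf->.
subst g; exists Y; split=> // sh; set q := owner (partner h).
have mX: (k, partner h) \in X q.
  apply/negPn/negP => mX; have: grank (k, h) <= grank (k, partner h).
    apply: kminE mX; move: kg; rewrite !mem_gevents => /and4P[-> -> + _].
    by rewrite phase_of_partner eqxx => ->.
  rewrite leqNgt /grank /= ltn_add2l -{2}(partnerK h) erank_partner //.
  by rewrite esend_partner.
(* If the channel were empty, [pending_rcvs] would put the partner of [h] among the sends still
   pending at [q], although it has been executed. *)
have [Yq Eq] := pre q; have := pending_rcvs E Eq (g_cnt gi q p).
set n := size _; rewrite {1}/rcvs /= sh eqxx /= => RE; rewrite ltnNge.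
apply/negP => /drop_oversize D0; move: RE; rewrite D0 /=.
case defS: (snds p Yq) => [//|g Z] /= /eqP; rewrite eqseq_cons => /andP[/eqP].
move/(congr1 (@gpartner _ _ S)); rewrite gpartnerK => gE _.
have: g \in snds p Yq by rewrite defS mem_head.
rewrite -gE mem_filter => /andP[_ mY].
have := gevents_uniq 0 Psi q; rewrite Eq cat_uniq => /and3P[_ /hasPn/(_ _ mY)].
by rewrite mX.
Qed.

Lemma gevents_nilP k Psi p : (gevents k Psi p == [::]) = all (fun x =>
  events_of x p == [::]) Psi.
Proof. by elim: Psi k => //= x Psi IH k; rewrite -(IH k.+1);
  case: (events_of x p). Qed.

Lemma path_from f k : path (@nxt _ _ S) (ini S) f -> k <= size f ->
  path (@nxt _ _ S) (nth (ini S) (ini S :: f) k) (drop k f) /\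
  last (nth (ini S) (ini S :: f) k) (drop k f) = last (ini S) f.
Proof.
move=> fp le_k; have: nth (ini S) (ini S :: f) k = last (ini S) (take k f).
  by rewrite (last_nth (ini S)) size_takel // -[in LHS](cat_take_drop k f) -cat_cons nth_cat /= size_takel // ltnSn.
move=> ->; have := cat_take_drop k f; move: (take k f) (drop k f) fp => t d fp fE.
by move: fp; rewrite -fE cat_path last_cat => /andP[].
Qed.

Lemma complete_accepting (c : config protocol) s X f : crel c s X -> ginv s X ->
    prefix s f -> path (@nxt _ _ S) (ini S) f -> fin (last (ini S) f) ->
    (forall p, X p = gevents 0 (ini S :: f) p) -> accepting c.
Proof.
move=> [lE cE] gi sf fp ff Xf; split=> [p|p q]; last first.
  rewrite cE /channel (_ : drop _ _ = [::]) // drop_oversize //.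
  by rewrite !Xf gevents_fifo size_map.
rewrite -[is_true _]/(is_true (accepts p (local c p))) lE /accepts.
have [k [le_k cu E Xp]] := lstate_spec p gi.
have /prefixP[u fE] := sf.
have le_kf : k <= size f by rewrite fE size_cat (leq_trans le_k) // leq_addr.
have cuf : current_phase (lstate s (X p)) = nth (ini S) (ini S :: f) k.
  by rewrite cu fE -cat_cons nth_cat /= ltnS le_k.
have: size (gevents 0 (ini S :: f) p) = size (X p) by rewrite Xf.
rewrite fE -cat_cons gevents_cat E -!catA !size_cat => /eqP.
rewrite -[X in _ == X]addn0 eqn_add2l !addn_eq0 size_map =>
  /and3P[/nilP t0 /nilP g0 /nilP u0].
rewrite t0 /=.
have all_k : all (fun x => events_of x p == [::]) (drop k f).
  rewrite fE drop_cat ltn_neqAle le_k andbT; case: eqP => [->|_].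
    by rewrite subnn drop0 -(gevents_nilP (0 + size (ini S :: s))) u0.
  by rewrite all_cat -(gevents_nilP k.+1) g0 -(gevents_nilP (0 + size (ini S :: s))) u0.
case: eqP => [ci|ci]; last first.
  have [pk lk] := path_from fp le_kf; rewrite -cuf in pk lk.
  rewrite (promise_none (j := 0) pk (introN eqP ci)) ?lk //.
  by apply/eqP; rewrite gevents_nilP.
have k0 : k = 0 by apply: ini_first (g_path gi) le_k _; rewrite -cu.
subst k; rewrite drop0 in all_k.
case: Xp => [[_ X0]|[l [e X1]]].
  (* The opener has executed nothing, so the first phase [y] of [f] has none of its events, hence no
     event at all. Then [y] has no decision and must be final. *)
  rewrite X0 /=; apply/implyP => /eqP vp; have [_ _ nf] := opener_ini vp.
  case: f {sf fE le_kf cuf} Xf fp ff all_k => [|y f] Xf /=;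
    first by rewrite (negPf nf).
  move=> /andP[iy _] _ /andP[/eqP y0 _]; apply/existsP; exists y.
  rewrite iy y0 eqxx andbT /=; apply/negPn/negP => /(nxt_decision iy).
  case dy: (decision y) => [d|//] _; have [phd _] := informed_decision dy.
  have: d \in events_of y (owner d) by rewrite mem_events_of phd !eqxx.
  by rewrite (opener_nxt vp iy y0).
rewrite X1 lstate_rcons /nu /=; case: ifP => // ke.
have lt0 : 0 < size s by apply: (g_informed gi (p := p)) ke;
  rewrite X1 mem_rcons mem_head.
by move/allP: all_k; apply; rewrite fE mem_cat mem_nth.
Qed.

Lemma extend_run s : path (@nxt _ _ S) (ini S) s ->
  exists f, [/\ prefix s f, path (@nxt _ _ S) (ini S) f & fin (last (ini S) f)].
Proof.
case/lastP: s => [_|s y].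
  by have [f fp ff] := ini_reach S; exists f; rewrite prefix0s.
rewrite rcons_path => /andP[sp sy]; have [t tp tf] := nxt_reach sy.
exists (rcons s y ++ t); rewrite prefix_prefix cat_path last_cat last_rcons.
by rewrite rcons_path sp sy.
Qed.

Lemma accepting_complete (c : config protocol) s X : crel c s X -> ginv s X ->
    opened s X -> accepting c ->
  exists f, [/\ path (@nxt _ _ S) (ini S) f, fin (last (ini S) f)
    & forall p, X p = gevents 0 (ini S :: f) p].
Proof.
move=> [lE cE] gi gv [acc emp]; have [f [sf fp ff]] := extend_run (g_path gi).
have [Xf|[p [k [h [Y [E rh kmin]]]]]] := min_pending gi sf; first by exists f.
(* An enabled receive would mean a nonempty channel. *)
have sh : esend h.
  apply/negPn/negP => sh; have lt_n := rh sh.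
  have := emp (owner (partner h)) p; rewrite cE /channel => /(congr1 size)/eqP.
  by rewrite size_map size_drop subn_eq0 leqNgt lt_n.
have := acc p; rewrite -[is_true _]/(is_true (accepts p (local c p))) lE =>
  /andP[/eqP t0].
have [s0 [b _ le_k]] := locate gi gv sf fp E rh.
case: b => [sE|[sE vp X0 _]]; last first.
  (* The opener accepts without having moved, so some final phase [y] after the initial one has no
     event of the opener, hence no event at all, and [[:: y]] completes the run. The other processes
     have finished the initial phase, since [h] comes after it and is a least pending event. *)
  have Y0 q := g_pre gi q; rewrite X0 vp eqxx /= eqxx =>
    /existsP[y /and3P[iy fy /eqP y0]].
  have [i0 _ _] := opener_ini vp; have y0' := opener_nxt vp iy y0.
  exists [:: y]; split=> //=; first by rewrite iy.
  move=> q; rewrite y0' /= !cats0; subst s; have [[|[k1 e] Z]] := Y0 q.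
    by rewrite cats0 /= cats0 => ->.
  rewrite /= cats0 => E1; have eX: (k1, e) \notin X q.
    have := gevents_uniq 0 [:: ini S] q; rewrite /= cats0 E1 cat_uniq /=.
    by case/and3P=> _ /norP[].
  have e_in: (k1, e) \in map (pair 0) (events_of (ini S) q) by rewrite E1 mem_cat mem_head orbT.
  have k10: k1 = 0 by case/mapP: e_in => ? _ [].
  have := kmin q (k1, e); rewrite /= mem_cat e_in => /(_ isT eX).
  rewrite leqNgt k10 => /negP[]; rewrite /grank /= mul0n add0n.
  have [_ [_ [_ _ _ [_ phh oh]]]] := gevents_next E.
  case: k {E kmin le_k k10} phh => [phh|k _].
    have: h \in events_of (ini S) p by rewrite mem_events_of oh phh !eqxx.
    by rewrite i0.
  apply: leq_trans (erank_bound e) _.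
  by rewrite mulSn -addnA leq_addr.
subst s0; have /prefixP[u fE] := sf; rewrite fE in E.
have {}E := gevents_prefix gi le_k E; case: E => Y' E.
have [t1 [t2 [sqE oh _ phh st]]] := state_next gi E.
case: st => [[tE _]|[t10 _ _ [k' [lt_k' cu YE]]]]; first by rewrite t0 in tE.
have le_k' : k' <= size s by apply: leq_trans le_k; apply: ltnW.
have [pk _] := path_from (g_path gi) le_k'.
case: eqP => [ci|ci /eqP pn]; last first.
  by rewrite -cu in pk; rewrite (promise_pending pk (introN eqP ci) YE) in pn.
rewrite t10 /= in sqE; case: k lt_k' le_k phh E {rh kmin fE YE} =>
  // k _ le_k phh E.
have [[l [g [X1 kg]]]|[_ vp X0 _]] := first_send (g_path gi) E sqE sh.
  by rewrite X1 lstate_rcons /nu /= kg -[nth _ _ _]phh sqE.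
by have := gv _ vp (leq_ltn_trans (leq0n _) le_k); rewrite X0.
Qed.

Definition procs : seq P := undup [seq owner e | e <- enum (pevent S)].

(** The number of events of [f] still to be executed, a measure that each step of [run_finish]
    decreases. *)
Definition pending f X :=
  \sum_(p <- procs) (size (gevents 0 (ini S :: f) p) - size (X p)).

Lemma pending_step f X p k h Y : gevents 0 (ini S :: f) p = X p ++ (k, h) :: Y ->
  pending f (updX X (k, h)) < pending f X.
Proof.
move=> E; have [_ [_ [_ _ _ [_ _ oh]]]] := gevents_next E.
have p_in: p \in procs by rewrite mem_undup -oh map_f // mem_enum.
rewrite /pending (bigD1_seq p p_in (undup_uniq _)) [ltnRHS](bigD1_seq p p_in (undup_uniq _)).
rewrite [in ltnLHS](eq_bigr (fun q =>
  size (gevents 0 (ini S :: f) q) - size (X q))).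
  rewrite -addSn leq_add2r
    /updX -[(k, h).2]/h oh eqxx E size_rcons size_cat [size (_ :: _)]/=.
  by lia.
by move=> q /negPf qp; rewrite /updX -[(k, h).2]/h oh qp.
Qed.

Lemma run_finish f : path (@nxt _ _ S) (ini S) f -> fin (last (ini S) f) ->
  forall n (c : config protocol) s X,
    crel c s X -> ginv s X -> opened s X -> prefix s f -> pending f X < n ->
  exists2 c', reachable c c' & accepting c'.
Proof.
move=> fp ff; elim=> // n IHn c s X cr gi gv sf le_n.
have [Xf|[p [k [h [Y [E rh _]]]]]] := min_pending gi sf.
  by exists c; [exists [::]|exact: complete_accepting cr gi sf fp ff Xf].
have [s' [a [c' [st _ cr' gi' [gv' sf']]]]] := step_fwd cr gi gv sf fp ff E rh.
have [|c2 [v ev] acc] := IHn _ _ _ cr' gi' gv' sf'.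
  exact: leq_trans (pending_step E) le_n.
by exists c2 => //; exists (a :: v), c'.
Qed.

Lemma map_gevents k Psi p : map (fun g => act g.2) (gevents k Psi p) =
  flatten [seq map (@act _ _ _) (events_of x p) | x <- Psi].
Proof. by elim: Psi k => //= x Psi IH k; rewrite map_cat IH -map_comp. Qed.

Lemma init_inv (X := (fun=> [::]) : P -> seq (gevent S)) :
  [/\ crel (init_config protocol) [::] X, ginv [::] X, opened [::] X & tied [::] X].
Proof.
split=> //; split=> //; by move=> p; eexists.
Qed.

(** The phases decided in a reachable configuration extend to a full path, which can be executed to
    its end: there is no deadlock. The two inclusions combine [run_back] with [accepting_complete],
    and [run_fwd] with [complete_accepting]. *)
Theorem protocolP : deadlock_free protocol /\
  forall w, (exists v, cfm_lang protocol v /\ w = map (relabel fst) v) <->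
    exists f, [/\ path (@nxt _ _ S) (ini S) f, fin (last (ini S) f),
      forall p, proj w p = flatten [seq map (@act _ _ _) (events_of x p) | x <- ini S :: f]
      & causal w].
Proof.
have [cr0 gi0 gv0 w0] := init_inv; split=> [[c [[v ev] dl]]|w].
  have [s [X [cr gi gv _]]] := run_back cr0 gi0 gv0 w0 ev.
  have [f [sf fp ff]] := extend_run (g_path gi); apply: dl.
  by have [c' cc' acc] := run_finish fp ff cr gi gv sf (ltnSn _); exists c'.
split=> [[v [[c [ev acc]] ->]]|[f [fp ff wf wc]]].
  have [s [X [cr gi gv [wX wc]]]] := run_back cr0 gi0 gv0 w0 ev.
  have [f [fp ff Xf]] := accepting_complete cr gi gv acc.
  by exists f; split=> // p; rewrite wX Xf map_gevents.
have wf' p : proj ([::] ++ w) p = map (fun g =>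
  act g.2) (gevents 0 (ini S :: f) p).
  by rewrite map_gevents wf.
have [v [c [s [X [ev vE cr gi [gv sf wX]]]]]] :=
  run_fwd fp ff cr0 gi0 gv0 (prefix0s f) w0 wf' wc.
exists v; split=> //; exists c; split=> //.
apply: (complete_accepting cr gi sf fp ff) => p.
have [Y E] := prefix_pre p gi sf; have := wX.1 p; rewrite wf' E map_cat => /eqP.
rewrite -[X in _ == X]cats0 eqseq_cat // => /andP[_ /eqP Y0].
by case: Y E Y0 => //; rewrite cats0.
Qed.

End Machine.

(** * The phases of a controllable-choice MSG *)

Section Family.
Variables (P C : eqType) (N : finType) (M : N -> bmsc P C).
Variable d0 : forall x, option (event (M x)).
Implicit Types (x : N) (p : P).

Definition fevent : finType := {x : N & event (M x)}.
Implicit Types (e h : fevent).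

Definition inF x (e : event (M x)) : fevent := Tagged (fun x => event (M x)) e.

Definition fown e := proc (tagged e).
Definition fmt e : fevent := inF (mate (tagged e)).
Definition flb e := label (tagged e).
Definition fsd : pred fevent := fun e => sends (tagged e).
Definition fsq x p : seq fevent := map (@inF x) (evs (M x) p).
Definition frk e := height (tagged e).
Definition fdec x : option fevent := omap (@inF x) (d0 x).
Definition fkn : pred fevent :=
  fun e => if d0 (tag e) is Some d then vis d (tagged e) else false.

Lemma inF_inj x : injective (@inF x).
Proof. exact: eq_from_Tagged. Qed.

Lemma fsq_uniq x p : uniq (fsq x p).
Proof. by rewrite map_inj_uniq ?evs_uniq //; apply: inF_inj. Qed.

Lemma mem_fsq x p e : (e \in fsq x p) = (tag e == x) && (fown e == p).
Proof.
apply/mapP/andP => [[f fp ->]|]; first by rewrite mem_evs in fp; rewrite eqxx.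
by case: e => y e [/eqP /= yx]; subst y => pe; exists e; rewrite ?mem_evs.
Qed.

Lemma fmtK : involutive fmt.
Proof. by case=> x e; rewrite /fmt /inF /= mateK. Qed.

Lemma fsd_mt e : fsd (fmt e) = ~~ fsd e.
Proof. exact: sends_mate. Qed.

Lemma flb_mt e : flb (fmt e) = flb e.
Proof. exact: label_mate. Qed.

Lemma fsq_fifo x p q :
  [seq e <- fsq x q | ~~ fsd e && (fown (fmt e) == p)] =
  map fmt [seq e <- fsq x p | fsd e && (fown (fmt e) == q)].
Proof.
rewrite /fsq !filter_map -map_comp.
rewrite [RHS](_ : _ = map (@inF x) (map (@mate _ _ _)
  [seq e <- evs (M x) p | sends e && (proc (mate e) == q)])).
  by rewrite -evs_fifo.
by rewrite -map_comp.
Qed.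

Lemma frk_mt e : fsd e -> frk e < frk (fmt e).
Proof.
move=> se; apply: height_lt; first exact: vis_mate.
by apply/eqP => E; have := sends_mate (tagged e);
  rewrite -[mate _]/(tagged (fmt e)) -E -[sends _]/(fsd e) se.
Qed.

Lemma fsq_pairwise x p (r : rel fevent) :
  (forall e f : event (M x), ple e f -> e != f -> r (inF e) (inF f)) ->
  pairwise r (fsq x p).
Proof.
move=> rP; rewrite /fsq pairwise_map; have := evs_pairwise (M x) p.
have := evs_uniq (M x) p; elim: (evs _ p) => //= e s IH /andP[es us] /andP[le ls].
rewrite IH // andbT; apply/allP => f fs; apply: rP; first exact: (allP le).
by apply: contraNneq es => ->.
Qed.

Lemma frk_sq x p : pairwise (fun e f => frk e < frk f) (fsq x p).
Proof.
by apply: fsq_pairwise => e f ef neq; apply: height_lt neq; apply: vis_ple.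
Qed.

Lemma fkn_dec x e : fdec x = Some e -> tag e = x /\ fkn e.
Proof.
rewrite /fdec; case dx: (d0 x) => [d|] //= [<-]; split=> //.
by rewrite /fkn /= dx; apply: connect0.
Qed.

Lemma fkn_succ x p s1 e h s2 : fsq x p = s1 ++ e :: h :: s2 -> fkn e -> fkn h.
Proof.
move=> E; have: pairwise (fun e f => fkn e ==> fkn f) (fsq x p).
  apply: fsq_pairwise => f g fg _; apply/implyP; rewrite /fkn /=.
  case: (d0 x) => // d df; apply: connect_trans df _; exact: vis_ple.
by rewrite E pairwise_cat /= => /and5P[_ _ /andP[/implyP]].
Qed.

Lemma fkn_mt e : fsd e -> fkn e -> fkn (fmt e).
Proof.
rewrite /fkn /=; case: (d0 _) => // d se de.
by apply: connect_trans de _; apply: vis_mate.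
Qed.

Lemma fkn_inv h : fkn h -> [\/ fdec (tag h) = Some h,
    exists s1 e s2, fsq (tag h) (fown h) = s1 ++ e :: h :: s2 /\ fkn e |
    ~~ fsd h /\ fkn (fmt h)].
Proof.
case: h => x h; rewrite /fkn /fdec /fown /=; case dx: (d0 x) => [d|] //.
case/vis_inv => [->|[g dg /orP[/andP[gh le_gh]|/andP[sg /eqP hE]]]].
- by constructor 1.
- constructor 2;
    have gin: g \in evs (M x) (proc h) by rewrite mem_evs (ple_proc le_gh).
  have hin: h \in evs (M x) (proc h) by rewrite mem_evs.
  have [t1 [t2 tE]]: exists t1 t2, evs (M x) (proc h) = t1 ++ h :: t2.
    by case/splitPr: hin => t1 t2; exists t1, t2.
  have := evs_pairwise (M x) (proc h); rewrite tE pairwise_cat /=.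
  case/and4P=> _ p1 /allP h_t2 _.
  move: gin; rewrite tE mem_cat inE (negPf gh) /= => /orP[gt1|/h_t2 hg];
    last first.
    by rewrite (@ple_anti _ _ (M x) g h) ?eqxx ?le_gh in gh.
  case/lastP: t1 => [//|t1 e] in tE p1 gt1 *.
  (* The event [g] need not be adjacent to [h]; the adjacent event [e] is [g] or lies above it, so
     it is informed too. *)
  exists (map (@inF x) t1), (inF e), (map (@inF x) t2); split.
    by rewrite /fsq /= tE map_cat map_rcons cat_rcons.
  rewrite /= dx.
  move: gt1 p1; rewrite mem_rcons inE -cats1 pairwise_cat allrel1r =>
    /orP[/eqP<-|gt1] /andP[/allP gevent _].
    by [].
  by apply: connect_trans dg _; apply: vis_ple; apply: gevent.
constructor 3; rewrite hE mateK /fsd /= sends_mate sg.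
by split.
Qed.

End Family.

(** * Cycles, long paths and forced paths of the graph *)

Section Paths.
Variables (P C : eqType) (G : msg P C).
Notation V := (node G).
Notation E := (@edge _ _ G).
Implicit Types (u x y : V) (l q : seq V).

Lemma unique_succ u x y : ~~ choice_node u -> E u x -> E u y -> x = y.
Proof.
rewrite /choice_node -leqNgt => /card_le1_eqP c ux uy; exact: c.
Qed.

Lemma choice_sink : ~~ choice_node (sink G).
Proof.
rewrite /choice_node -leqNgt (eq_card0 (A := [pred t | E (sink G) t])) //.
by move=> t; rewrite inE; apply/negbTE/sink_out.
Qed.

(** Without a choice node, no path could leave the cycle; but the sink is reachable and lies on no
    cycle. *)
Lemma cycle_choice c : c != [::] -> cycle E c -> has (@choice_node _ _ G) c.
Proof.
move=> c0 cc; apply/negPn/negP => /hasPn nc.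
have [x xc]: exists x, x \in c by case: (c) c0 => // x c' _; exists x;
  rewrite mem_head.
have next_in y : y \in c -> next c y \in c by rewrite mem_next.
have stay l : forall y, y \in c -> path E y l -> last y l \in c.
  elim: l => //= z l IH y yc /andP[yz zl]; apply: IH zl.
  by rewrite (unique_succ (nc y yc) yz (next_cycle cc yc)) next_in.
have /connectP[l xl lE] := sink_reach x; have := stay l x xc xl; rewrite -lE =>
  sc.
by have := next_cycle cc sc; rewrite (negPf (sink_out _)).
Qed.

(* Pairing each node with the number of choice nodes met so far makes the nodes
   of a path distinct as long as no choice node repeats. *)
Fixpoint stamp n l : seq (V * nat) :=
  if l is x :: l' then
    (x, n + choice_node x) :: stamp (n + choice_node x) l'
  else [::].

Lemma mem_stamp n l y m : (y, m) \in stamp n l ->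
  exists b d, l = b ++ y :: d /\ m = n + count (@choice_node _ _ G) (rcons b y).
Proof.
elim: l n => //= x l IH n; rewrite inE => /predU1P[[-> ->]|/IH[b [d [-> ->]]]].
  by exists [::], l; rewrite /= addn0.
by exists (x :: b), d; rewrite /= addnA.
Qed.

Lemma size_stamp n l : size (stamp n l) = size l.
Proof. by elim: l n => //= x l IH n; rewrite IH. Qed.

(** A repeated pair would close a cycle without choice nodes. *)
Lemma stamp_uniq n u l : path E u l -> uniq [seq x <- l | choice_node x] ->
  uniq (stamp n l).
Proof.
elim: l n u => //= x l IH n u /andP[_ xl] ul.
have ul' : uniq [seq x <- l | choice_node x] by case: ifP ul => // _ /andP[].
rewrite (IH _ x) // andbT; apply/negP => /mem_stamp[b [d [lE]]].
rewrite -[LHS]addn0 => /eqP; rewrite eqn_add2l eq_sym -leqn0 leqNgt -has_count =>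
  /negP nc.
have cb : path E x (rcons b x).
  by move: xl; rewrite lE -cat_rcons cat_path => /andP[].
by case: nc; rewrite has_rcons; apply: (@cycle_choice (x :: b)).
Qed.

(** The number of pairs of a node and a count between 0 and [#|V|], that is, of the stamps of a path
    without repeated choice nodes. *)
Definition bound := #|V| * #|V|.+1.

(** The first [bound.+1] nodes are more than the available stamps, so a choice node occurs twice
    among them. *)
Lemma long_path u l : path E u l -> bound < size l ->
  exists a c b d, [/\ l = a ++ c :: b ++ c :: d, choice_node c
    & size (a ++ c :: rcons b c) <= bound.+1].
Proof.
move=> ul lt_l; pose k := take bound.+1 l.
have sk : size k = bound.+1 by rewrite size_takel.
have uk : path E u k by move: ul;
  rewrite -{1}(cat_take_drop bound.+1 l) cat_path => /andP[].
have [uq|nuq] := boolP (uniq [seq x <- k | choice_node x]).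
  have: size (stamp 0 k) <= size [seq (x, n) | x <- enum V, n <- iota 0 #|V|.+1].
    apply: uniq_leq_size (stamp_uniq _ uk uq) _ =>
      -[x m] /mem_stamp[b [d [kE ->]]].
    apply: allpairs_f; rewrite ?mem_enum // add0n mem_iota add0n ltnS /=.
    apply: leq_trans (_ : count (@choice_node _ _ G) k <= _).
      by rewrite kE -cat_rcons count_cat leq_addr.
    by rewrite -size_filter -(card_uniqP uq) max_card.
  by rewrite size_stamp sk size_allpairs -cardE size_iota ltnn.
have [c [cc c2]]: exists c, choice_node c /\ 1 < count_mem c k.
  move: nuq => /(uniqPn u)[i [j [ij js E2]]].
  pose f := [seq x <- k | choice_node x]; exists (nth u f i).
  have fi : nth u f i \in f by rewrite mem_nth // (ltn_trans ij).
  move: (fi); rewrite mem_filter => /andP[ci _]; split=> //.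
  rewrite -[count_mem _ _](_ : count_mem (nth u f i) f = _); last first.
    by rewrite count_filter; apply: eq_count => z /=; case: eqP => // ->;
      rewrite ci.
  rewrite ltnNge; apply/negP => le1.
  have := cat_take_drop j f; move=> fE; move: le1; rewrite -{2}fE count_cat.
  have: nth u f i \in take j f.
    by rewrite -(nth_take u ij) mem_nth // size_takel // ltnW.
  have: nth u f i \in drop j f.
    by rewrite E2 -[j in nth _ _ j]addn0 -nth_drop mem_nth // size_drop subn_gt0.
  rewrite -!has_pred1 !has_count; lia.
have ck : c \in k by rewrite -has_pred1 has_count; lia.
move: c2; have kd : l = k ++ drop bound.+1 l by rewrite cat_take_drop.
have [a [k' [kE ca]]]: exists a k', k = a ++ c :: k' /\ c \notin a.
  exists (take (index c k) k), (drop (index c k).+1 k); split.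
    by rewrite -{1}(cat_take_drop (index c k) k) (drop_nth c) ?index_mem // nth_index.
  by rewrite in_take ?ltnn.
rewrite kE count_cat /= eqxx (count_memPn ca) add0n add1n ltnS -has_count has_pred1.
move=> ck'; have [b [d k'E]]: exists b d, k' = b ++ c :: d.
  by case/splitPr: ck' => b d; exists b, d.
exists a, c, b, (d ++ drop bound.+1 l); split=> //.
  by rewrite {1}kd kE k'E -!catA /= -!catA.
rewrite -sk kE k'E !size_cat /= size_rcons size_cat /=; lia.
Qed.

(** Nodes before the first choice node have only one successor, so all paths to the sink begin in
    the same way. *)
Lemma first_choice u l : path E u l -> last u l = sink G ->
  exists q, [/\ path E u q, last u q = sink G \/ choice_node (last u q)
    & forall l', path E u l' -> last u l' = sink G -> exists l2, l' = q ++ l2].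
Proof.
elim: l u => [|t l IH] u /=; first by move=> _ us; exists [::]; split;
  [|left|move=> l' _ _; exists l'].
case/andP=> ut tl lE; have [cu|cu] := boolP (choice_node u).
  by exists [::]; split; [|right|move=> l' _ _; exists l'].
have [q [tq lq qP]] := IH t tl lE; exists (t :: q); split=> //=;
  first by rewrite ut.
case=> [_ /= us|t' l' /= /andP[ut' tl'] lE'].
  by have := ut; rewrite us (negPf (sink_out t)).
have tt := unique_succ cu ut ut'; subst t'; have [l2 ->] := qP l' tl' lE'.
by exists l2.
Qed.

End Paths.

(** * Cutting a run into segments of bounded length *)

Section Segments.
Variables (P C : eqType) (G : msg P C).
Notation V := (node G).
Notation E := (@edge _ _ G).
Implicit Types (u x y : V) (l q : seq V) (p r : P).

Definition good (M : bmsc P C) u (e : event M) :=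
  forall p, triggers u p -> exists f : event M, proc f = p /\ vis e f.

(** The chart of a path given by the list of all its nodes; the value on the empty list is a
    filler. *)
Definition bchart l := if l is t :: q then path_chart t q else chart (source G).

Definition prf p x := profile (chart x) p.

Lemma profile_bchart l p : l != [::] ->
  profile (bchart l) p = flatten (map (prf p) l).
Proof. by case: l => // t q _; apply: profile_path. Qed.

Lemma good_resolving (M : bmsc P C) u (e : event M) :
  resolving e (triggers u) -> good u e.
Proof. by case. Qed.

(** If [c] is local-choice, the cycle is itself a continuation after [c], so a minimal event of it
    is on the only triggering process, and it is good because it lies above itself. *)
Lemma cycle_good : controllable_choice G -> forall c l,
    choice_node c -> path E c l -> last c l = c -> l != [::] ->
  (forall p, profile (bchart l) p = [::]) \/ exists e : event (bchart l), good c e.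
Proof.
move=> hG c [//|t q] cc /= /andP[ct tq] lE _.
case: (hG c cc) => [[r rP]|[_ /(_ t q ct tq lE)[e /good_resolving gevent]]];
  last first.
  by right; exists e.
have [[e _]|no_e] := pselect (exists e : event (path_chart t q), True).
  right; have [f [_ fmin]] := minimal_event e; exists f => p tp.
  have tf : triggers c (proc f) by exists t, q; split=> //; exists f.
  exists f; split; last exact: connect0.
  by rewrite (proj1 (rP _) tf) (proj1 (rP _) tp).
by left; apply/profile0P => e; apply: no_e; exists e.
Qed.

Lemma good_suffix u s q1 t q2 :
  (exists e : event (path_chart t q2), good u e) ->
  exists e : event (path_chart s (q1 ++ t :: q2)), good u e.
Proof.
case=> e gevent; have [h [hp hv]] := vis_suffix s t q1 q2.
exists (h e) => p /gevent[f [fp ef]]; exists (h f); split; first by rewrite hp.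
exact: hv.
Qed.

Definition segment : finType := (bound G).+1.-bseq V.
Implicit Types (ls : seq segment).

Definition closed u l : bool :=
  (u == sink G) || `[< exists e : event (bchart l), good u e >].

Fixpoint chain u ls : bool :=
  if ls is l :: ls' then
    [&& l != [::] :> seq V, path E u l, closed (last u l) l & chain (last u l) ls']
  else true.

Lemma decompose : controllable_choice G -> forall n u l, size l < n ->
    path E u l -> l != [::] -> last u l = sink G ->
  exists ls, [/\ chain u ls, last u (flatten (map val ls)) = sink G
    & forall p, flatten (map (prf p) (flatten (map val ls))) =
                flatten (map (prf p) l)].
Proof.
move=> hG; elim=> // n IHn u l lt_n ul l0 lE.
have [le_l|lt_l] := leqP (size l) (bound G).+1.
  exists [:: Bseq le_l]; rewrite /= cats0; split=> //.
  by rewrite l0 ul /closed lE eqxx.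
have [a [c [b [d [lE' cc sz]]]]] := long_path ul (ltnW lt_l).
have pth := ul; rewrite lE' cat_path /= cat_path /= in pth.
case/and4P: pth => ua ac cb /andP[bc cd].
(* The sink is not a choice node, so the path continues after [c]. *)
have d0 : d != [::].
  apply: contraTneq cc => d0; have := lE.
  by rewrite lE' d0 last_cat /= last_cat /= => ->; apply: choice_sink.
have cloop : path E c (rcons b c) by rewrite rcons_path cb.
have [|b0|gevent] := cycle_good hG cc cloop (last_rcons _ _ _);
  first by case: (b).
  (* A cycle without events is erased, which leaves the process words unchanged. *)
  have [||||ls [lsc lsl lsp]] := IHn u (a ++ c :: d).
  - by move: lt_n; clear -lE'; rewrite lE' !size_cat /= !size_cat /=; lia.
  - by rewrite cat_path /= ua ac cd.
  - by case: (a).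
  - by rewrite last_cat /= -lE lE' last_cat /= last_cat.
  exists ls; split=> // p; rewrite lsp lE'.
  have -> : a ++ c :: b ++ c :: d = rcons a c ++ rcons b c ++ d by rewrite !cat_rcons.
  have := b0 p; rewrite profile_bchart -?cat_rcons ?map_cat ?flatten_cat =>
    [->//|].
  by case: (b).
(* Otherwise the first segment ends at the second occurrence of [c]; the good event of the cycle,
   which is a suffix of the segment, closes it. *)
have dl : last c d = sink G by rewrite -lE lE' last_cat /= last_cat.
have [||||ls [lsc lsl lsp]] := IHn c d => //.
  by move: lt_n; clear -lE'; rewrite lE' !size_cat /= !size_cat /=; lia.
exists (Bseq sz :: ls) => /=; rewrite last_cat /= last_rcons; split.
- rewrite lsc andbT; apply/and3P; split; first by case: (a).
    by rewrite cat_path /= ua ac cloop.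
  apply/orP; right; apply/asboolP; move: gevent.
  case bE: (rcons b c) => [|t q] gevent; first by have := size_rcons b c;
    rewrite bE.
  by case: (a) => [|s q1] /=; [apply: (good_suffix c [::])|rewrite -cat_rcons;
    apply: good_suffix].
- by rewrite last_cat last_cat /= last_rcons.
move=> p; rewrite lE' map_cat flatten_cat lsp -flatten_cat -map_cat.
by rewrite -catA /= cat_rcons.
Qed.

Definition procsG : seq P :=
  flatten [seq [seq proc e | e <- enum (event (chart x))] | x <- enum V].

Definition pindex : finType := 'I_(size procsG).+1.
(** Makes finite data out of processes, as [P] may be infinite: all processes without events share
    the last index. *)
Definition ix p : pindex := inord (index p procsG).

Lemma ix_inj p p' : p \in procsG -> ix p = ix p' -> p = p'.
Proof.
move=> pin /(congr1 val); rewrite /ix /= !inordK ?ltnS ?index_size // => E1.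
have p'in : p' \in procsG by rewrite -index_mem -E1 index_mem.
by rewrite -(nth_index p pin) E1 nth_index.
Qed.

Lemma bchart_proc l (e : event (bchart l)) : proc e \in procsG.
Proof.
have in1 x (f : event (chart x)) : proc f \in procsG.
  by apply/flatten_mapP; exists x; rewrite ?mem_enum // map_f // mem_enum.
case: l e => [|t q] /=; first exact: in1.
elim: q t => [|t' q IH] t /=; first exact: in1.
by case=> e /=; [apply: in1|apply: IH].
Qed.

Definition actv l : {set pindex} := [set ix (proc e) | e in event (bchart l)].

Lemma mem_actv l p : (ix p \in actv l) = (evs (bchart l) p != [::]).
Proof.
apply/imsetP/idP => [[e _ /esym E1]|].
  rewrite -(ix_inj (bchart_proc e) E1); have: e \in evs (bchart l) (proc e).
    by rewrite mem_evs.
  by case: (evs _ _).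
case pE: (evs (bchart l) p) => [//|e s] _; exists e => //.
have: e \in evs (bchart l) p by rewrite pE mem_head.
by rewrite mem_evs => /eqP->.
Qed.

End Segments.

(** * Phases annotated with promises *)

Section Instance.
Variables (P C : eqType) (G : msg P C).
Notation V := (node G).
Notation E := (@edge _ _ G).
(* [q0] is the path of the first phase, after the source, and [vd] the opener. *)
Variables (q0 : seq V) (vd : option P).
Let u0 := last (source G) q0.
Let M0 := path_chart (source G) q0.
Hypothesis vd_none : vd = None -> u0 = sink G \/ exists e : event M0, good u0 e.
Hypothesis vd_some : forall r, vd = Some r ->
  [/\ u0 <> sink G, forall p, triggers u0 p -> p = r, evs M0 r = [::]
    & ~ exists e : event M0, good u0 e].
Implicit Types (p r : P) (l : segment G) (ls : seq (segment G)).

Notation I := (pindex G).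
(* [None] is the first phase; [Some (l, lam, F)] is the phase with path l, where
   [lam] maps each process to its next phase after this one, and [F] is the set
   of processes active in the previous phases except the first. *)
Definition anode : finType :=
  option (segment G * {ffun I -> option (segment G)} * {set I})%type.
Implicit Types (x y : anode) (F : {set I}).

Definition lab x : seq V := if x is Some (l, _, _) then l else [::].
Definition lastn x := if x is Some (l, _, _) then last (source G) l else u0.
Definition chartn x := if x is Some (l, _, _) then bchart l else M0.
Definition okn x :=
  if x is Some (l, _, _) then closed (last (source G) l) l else true.

(** Promises are kept: the processes active in [l'] were promised [l'], the others retain their
    promise. A step from the first phase may choose the promises freely. *)
Definition astep x y :=
  if y is Some (l', lam', F') then
    [&& l' != [::] :> seq V, path E (lastn x) l', okn x, okn y &
     if x is Some (l, lam, F) then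
       (F' == F :|: actv l) &&
       [forall i, lam i == if i \in actv l' then Some l' else lam' i]
     else F' == set0]
  else false.

Definition afin x := (lastn x == sink G) &&
  (if x is Some (_, lam, _) then [forall i, lam i == None] else true).

(** Only phases that lead to a final one may be chosen, so that no promise is made that cannot be
    kept. *)
Definition anxt x y := astep x y && [exists f, afin f && connect astep y f].

Definition adec x : option (event (chartn x)) :=
  if lastn x == sink G then None
  else [pick e : event (chartn x) | `[< good (lastn x) e >]].

Definition firstev l p : option (bool * P) :=
  omap (fun e : event (bchart l) => (sends e, proc (mate e)))
    (ohead (evs (bchart l) p)).

Definition aprm x p :=
  if x is Some (_, lam, _) then
    if lam (ix G p) is Some l then firstev l p else None
  else None.

Definition afl x p := if x is Some (_, _, F) then ix G p \in F else false.

Lemma anxt_edge x y : anxt x y -> exists t q,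
  [/\ lab y = t :: q, E (lastn x) t & path E t q].
Proof.
case: y => [[[l lam] F]|]; rewrite /anxt /astep //= => /andP[/and3P[]].
by case: (l : seq V) => //= t q _ /andP[xt tq] _ _; exists t, q.
Qed.

Lemma anxt_nosink x y : anxt x y -> lastn x != sink G.
Proof.
move=> /anxt_edge[t [q [_ xt _]]]; apply/eqP => E1; move: xt.
by rewrite E1 (negPf (sink_out t)).
Qed.

Lemma initiates_triggers x y (e : event (chartn y)) : anxt x y ->
  (forall f, vis f e -> f = e) -> triggers (lastn x) (proc e).
Proof.
move=> xy; have [t [q [yE xt tq]]] := anxt_edge xy.
case: y xy yE e => [[[l lam] F]|] //= xy; rewrite /bchart => -> e emin.
by exists t, q; split=> //; exists e.
Qed.

Lemma adecP x e : adec x = Some e -> good (lastn x) e.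
Proof.
by rewrite /adec; case: eqP => // _; case: pickP => //= f /asboolP gf [<-].
Qed.

(** [okn] provides a good event in all other phases that do not end in the sink. *)
Lemma adec_none x : okn x -> lastn x != sink G -> adec x = None ->
  x = None /\ exists r, vd = Some r.
Proof.
rewrite /adec => ok /[dup] ns /negPf->; case: pickP => // ng _.
have no_good : ~ exists e : event (chartn x), good (lastn x) e.
  by case=> e gevent; have := ng e; rewrite (introT (asboolP _) gevent).
case: x ok ns no_good {ng} => [[[l lam] F]|] /=.
  by rewrite /closed => /orP[->//|/asboolP gevent] _ /(_ gevent).
move=> _ ns ng; split=> //; case vE: vd => [r|]; first by exists r.
by case: (vd_none vE) => [E1|//]; rewrite E1 eqxx in ns.
Qed.

Let asq := @fsq _ _ _ chartn.
Let akn := @fkn _ _ _ chartn adec.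

Lemma anxt_ini x y : anxt x y -> y != None.
Proof. by case: y. Qed.

Lemma afin_dec x : afin x -> fdec adec x = None.
Proof. by rewrite /afin /fdec /adec => /andP[/eqP-> _]; rewrite eqxx. Qed.

(** No step leaves a phase that ends in the sink, so the final phase it leads to is this phase
    itself. *)
Lemma anxt_fin_sink x y : anxt x y -> lastn y = sink G -> afin y.
Proof.
move=> /andP[_ /existsP[f /andP[ff /connectP[[|z s] /=]]]].
  by move=> _ fE _; rewrite -fE.
case/andP=> yz _ _ ys; exfalso; move: yz; case: z => [[[l lam] F]|] //=.
rewrite /astep ys; case: (l : seq V) => //= t q.
by rewrite (negPf (sink_out t)).
Qed.

Lemma anxt_ok x y : anxt x y -> okn x /\ okn y.
Proof.
by case: y => [[[l lam] F]|]; rewrite /anxt /astep // => /andP[/and5P[_ _ -> ->]].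
Qed.

Lemma anxt_dec x y : anxt x y -> ~~ afin y -> fdec adec y <> None.
Proof.
move=> xy nf; rewrite /fdec; case dy: (adec y) => //= _.
have ns : lastn y != sink G by apply: contra nf => /eqP; apply: anxt_fin_sink xy.
have [yN _] := adec_none (anxt_ok xy).2 ns dy.
by have := anxt_ini xy; rewrite yN.
Qed.

(** A first event that is a send is minimal, so [p] is a trigger of the last node of [x]. If [x] has
    a decision, it is good, hence below an event of [p], and so below the last event of [p] in
    [x]. *)
Lemma anxt_snd x y p h s : anxt x y -> asq y p = h :: s -> fsd h ->
  (exists s1 g, asq x p = rcons s1 g /\ akn g) \/ (x = None /\ vd = Some p).
Proof.
move=> xy; rewrite /asq /fsq; case yE: (evs (chartn y) p) => [//|e s'] [<- _] se.
have emin := first_send_minimal yE se.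
have ep : proc e = p by apply/eqP; rewrite -mem_evs yE mem_head.
have tp := initiates_triggers xy emin; rewrite ep in tp.
case dx: (adec x) => [d|]; last first.
  have [xN [r vr]] := adec_none (anxt_ok xy).1 (anxt_nosink xy) dx.
  right; split=> //; have [_ tr _ _] := vd_some vr.
  by rewrite vr (tr p) //; move: tp; rewrite xN.
left; have [f [fp df]] := adecP dx tp.
have: f \in evs (chartn x) p by rewrite mem_evs fp.
have := evs_pairwise (chartn x) p; case/lastP: (evs _ _) => [//|s1 g].
rewrite -cats1 pairwise_cat allrel1r => /andP[/allP fg _] fin.
exists (map (@inF _ _ _ chartn x) s1), (inF g); split;
  first by rewrite cats1 map_rcons.
rewrite /akn /fkn /= dx; move: fin; rewrite mem_cat inE => /orP[/fg|/eqP<- //].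
by move/vis_ple; apply: connect_trans.
Qed.

Lemma vd_ini r : vd = Some r ->
  [/\ asq None r = [::], fdec adec None = None & ~~ afin None].
Proof.
move=> vr; have [ns _ e0 ng] := vd_some vr; split.
- by rewrite /asq /fsq /= e0.
- rewrite /fdec /adec /=; case: eqP => // _; case: pickP => //= e /asboolP gevent.
  by case: ng; exists e.
by rewrite /afin /= andbT; apply/eqP.
Qed.

(** Any event has a minimal one below it, and the minimal events of [y] are all on [r]. *)
Lemma vd_next r y : vd = Some r -> anxt None y -> asq y r = [::] ->
  forall p, asq y p = [::].
Proof.
move=> vr xy; rewrite /asq /fsq; case yr: (evs (chartn y) r) => [|//] _ p.
have [_ tr _ _] := vd_some vr.
case: (evs (chartn y) p) => [//|e s]; have [f [_ fmin]] := minimal_event e.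
have := tr _ (initiates_triggers xy fmin) => fr.
by have := mem_evs r f; rewrite yr fr eqxx.
Qed.

Lemma astep_anxt x s : path astep x s -> afin (last x s) -> path anxt x s.
Proof.
elim: s x => //= y s IH x /andP[xy ys] active_before;
  rewrite IH // andbT /anxt xy.
by apply/existsP; exists (last y s); rewrite active_before; apply/connectP;
  exists s.
Qed.

Lemma anxt_reach x y : anxt x y -> exists2 s, path anxt y s & afin (last y s).
Proof.
case/andP=> _ /existsP[f /andP[ff /connectP[s ys fE]]]; exists s; rewrite -?fE //.
by apply: astep_anxt; rewrite -?fE.
Qed.

Lemma aprm_next x y p : anxt x y -> x != None ->
  aprm x p = if asq y p is e :: _ then Some (fsd e, fown (fmt e)) else aprm y p.
Proof.
case: x y => [[[l lam] F]|] [[[l' lam'] F']|] //; rewrite /anxt => /andP[+ _] _.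
rewrite /astep => /and5P[_ _ _ _ /andP[_ /forallP/(_ (ix G p))/eqP lE]].
rewrite /= lE mem_actv /asq /fsq /= /firstev.
by case eE: (evs (bchart l') p) => [//|e s] /=; rewrite eE.
Qed.

Lemma aprm_fin x p : x != None -> afin x -> aprm x p = None.
Proof.
case: x => [[[l lam] F]|] // _; rewrite /afin => /andP[_ /forallP/(_ (ix G p))].
by rewrite /= => /eqP->.
Qed.

Lemma afl_ini y p : anxt None y -> afl y p = false.
Proof.
case: y => [[[l lam] F]|] //; rewrite /anxt /astep =>
  /andP[/and5P[_ _ _ _ /eqP->] _].
by rewrite /= inE.
Qed.

Lemma afl_next x y p : anxt x y -> x != None ->
  afl y p = afl x p || (asq x p != [::]).
Proof.
case: x y => [[[l lam] F]|] [[[l' lam'] F']|] //; rewrite /anxt => /andP[+ _] _.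
rewrite /astep => /and5P[_ _ _ _ /andP[/eqP-> _]].
rewrite /= in_setU mem_actv /asq /fsq /=.
by case: (evs (bchart l) p).
Qed.

(** Each process is promised the first of the remaining segments in which it is active. Promises are
    thus computed from the end of the run, whereas [annot] collects the active processes from its
    beginning. *)
Definition lamof ls : {ffun I -> option (segment G)} :=
  foldr (fun l (lam : {ffun I -> option (segment G)}) => [ffun i =>
    if i \in actv l then Some l else lam i])
    [ffun=> None] ls.

Fixpoint annot F ls : seq anode :=
  if ls is l :: ls' then Some (l, lamof ls', F) :: annot (F :|: actv l) ls'
  else [::].

Lemma annot_path F ls x : chain (lastn x) ls -> okn x ->
    last (lastn x) (flatten (map val ls)) = sink G ->
    (if x is Some (l, lam, F0) then F = F0 :|: actv l /\ lam = lamof ls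
     else F = set0) ->
  path astep x (annot F ls) /\ afin (last x (annot F ls)).
Proof.
elim: ls F x => [|l ls IH] F x /=.
  move=> _ _ lE xE; split=> //; rewrite /afin lE eqxx /=.
  case: x xE {lE} => [[[l lam] F0]|] // [_ ->].
  by apply/forallP => i; rewrite ffunE.
case/and4P=> l0 xl cl lsc okx lE xE.
have lastE : last (lastn x) l = last (source G) l by case: (l : seq V) l0.
rewrite last_cat lastE in lE; rewrite lastE in cl lsc.
have [] := IH (F :|: actv l) (Some (l, lamof ls, F)) lsc cl lE; first by [].
move=> sp sf; split=> //; rewrite sp andbT /astep /= l0 xl okx cl /=.
case: x xE {xl okx lE lastE} => [[[l1 lam] F0]|] /=; last by move->.
by case=> -> ->; rewrite eqxx; apply/forallP => i; rewrite ffunE.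
Qed.

Hypothesis some_run : exists2 s, path anxt None s & afin (last None s).

Lemma ph_fmt (e : fevent chartn) : tag (fmt e) = tag e.
Proof. by []. Qed.

Definition msg_phases : phases P C :=
  @Phases P C anode (fevent chartn) (@tag _ _) (@fown _ _ _ chartn)
   (@fmt _ _ _ chartn) (@flb _ _ _ chartn) (@fsd _ _ _ chartn) asq
   (@frk _ _ _ chartn)
   (@fsq_uniq _ _ _ chartn) (@mem_fsq _ _ _ chartn) (@fmtK _ _ _ chartn)
   (@fsd_mt _ _ _ chartn) ph_fmt (@flb_mt _ _ _ chartn)
   (@fsq_fifo _ _ _ chartn) (@frk_mt _ _ _ chartn) (@frk_sq _ _ _ chartn)
   anxt None afin (fdec adec) akn vd aprm afl
   (@fkn_dec _ _ _ chartn adec) (@fkn_succ _ _ _ chartn adec)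
   (@fkn_mt _ _ _ chartn adec) (@fkn_inv _ _ _ chartn adec)
   anxt_ini afin_dec anxt_dec anxt_snd vd_ini vd_next
   some_run anxt_reach aprm_next aprm_fin afl_ini afl_next.

Lemma profile_asq x p :
  map (@act _ _ msg_phases) (asq x p) = profile (chartn x) p.
Proof. by rewrite /asq /fsq -map_comp; apply: eq_map. Qed.

Lemma anxt_path x f : path anxt x f ->
  path E (lastn x) (flatten (map lab f)) /\
  last (lastn x) (flatten (map lab f)) = lastn (last x f).
Proof.
elim: f x => //= y f IH x /andP[xy /IH[yp yl]].
rewrite cat_path last_cat; have -> : last (lastn x) (lab y) = lastn y.
  have [t [q [yE _ _]]] := anxt_edge xy.
  by case: y xy yE {yp yl} => [[[l lam] F]|] //= _ ->.
by rewrite yp yl andbT; have [t [q [-> /= -> ->]]] := anxt_edge xy.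
Qed.

Lemma profile_run f p : path anxt None f ->
  flatten [seq map (@act _ _ msg_phases) (asq x p) | x <- None :: f] =
  profile (path_chart (source G) (q0 ++ flatten (map lab f))) p.
Proof.
move=> fp; rewrite profile_path -cat_cons map_cat flatten_cat -profile_path.
rewrite [LHS]/= profile_asq; congr (_ ++ _).
elim: f None fp => //= y f IH x /andP[xy /IH->].
rewrite map_cat flatten_cat profile_asq; congr (_ ++ _).
have [t [q [yE _ _]]] := anxt_edge xy.
by case: y xy yE => [[[l lam] F]|] //= _ ->; apply: profile_path.
Qed.

End Instance.

(** * The first phase, and the conclusion *)

(** The first phase is the forced path to the first choice node or the sink. If it has no good event
    and does not end in the sink, the node is local-choice, and its process has no event there, as
    such an event would be good. *)
Lemma source_phase (P C : eqType) (G : msg P C) : controllable_choice G ->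
  exists (q0 : seq (node G)) (vd : option P),
  let u0 := last (source G) q0 in let M0 := path_chart (source G) q0 in
  [/\ path (@edge _ _ G) (source G) q0,
      forall l, path (@edge _ _ G) (source G) l -> last (source G) l = sink G ->
        exists l2, l = q0 ++ l2,
      vd = None -> u0 = sink G \/ exists e : event M0, good u0 e
    & forall r, vd = Some r ->
      [/\ u0 <> sink G, forall p, triggers u0 p -> p = r, evs M0 r = [::]
        & ~ exists e : event M0, good u0 e]].
Proof.
move=> hG; have /connectP[l lp lE] := sink_reach (source G).
have [q0 [q0p q0c q0P]] := first_choice lp (esym lE); exists q0.
have [us|ns] := eqVneq (last (source G) q0) (sink G).
  by exists None; split=> // _; left.
case: q0c => [us|cc]; first by rewrite us eqxx in ns.
have [gevent|nge] := pselect (exists e : event (path_chart (source G) q0),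
    good (last (source G) q0) e).
  by exists None; split=> // _; right.
case: (hG _ cc) => [[r rP]|[/(_ q0 q0p erefl)[e /good_resolving gevent] _]];
  last first.
  by case: nge; exists e.
exists (Some r); split=> // _ [<-]; split=> //; first exact/eqP.
  by move=> p /rP.
case rE: (evs _ r) => [//|e s]; case: nge; exists e => p /rP ->; exists e.
split; last exact: connect0.
by apply/eqP; rewrite -mem_evs rE mem_head.
Qed.

Theorem theorem2 (P C : eqType) (G : msg P C) (hG : controllable_choice G) :
  exists (D : finType) (A : cfm P (C * D)%type),
    deadlock_free A /\
    forall w : seq (action P C),
      (exists v, cfm_lang A v /\ w = map (relabel fst) v) <-> msg_lang G w.
Proof.
have [q0 [vd [q0p q0P vd_none vd_some]]] := source_phase hG.
(* Every continuation of [q0] to the sink has the process words of some path of phases, though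
   perhaps not the same nodes, since cycles without events are erased. *)
have annotE l2 : path (@edge _ _ G) (last (source G) q0) l2 ->
    last (last (source G) q0) l2 = sink G ->
  exists f, [/\ path (anxt q0) None f, afin q0 (last None f)
    & forall p, flatten (map (prf p) (flatten (map (@lab _ _ G) f))) =
                flatten (map (prf p) l2)].
  have [->|l20] := eqVneq l2 [::].
    by move=> _ /= lE; exists [::]; split=> //; rewrite /afin /= lE eqxx.
  move=> l2p l2E; have [ls [lsc lsl lsp]] := decompose hG (ltnSn _) l2p l20 l2E.
  have [sp sf] := @annot_path _ _ _ q0 set0 ls None lsc isT lsl erefl.
  exists (annot set0 ls); split=> //; first exact: astep_anxt.
  move=> p; rewrite -lsp; congr (flatten (map _ (flatten _))).
  by elim: (ls) (set0 : {set _}) => //= l ls' IH F; rewrite IH.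
have run0 : exists2 s, path (anxt q0) None s & afin q0 (last None s).
  have /connectP[l lp /esym lE] := sink_reach (source G).
  have [l2 lE2] := q0P l lp lE; rewrite lE2 cat_path last_cat in lp lE.
  by case/andP: lp => _ /annotE/(_ lE)[f [fp ff _]]; exists f.
pose S := msg_phases vd_none vd_some run0.
exists (know S), (protocol S); have [df lang] := protocolP S; split=> // w.
rewrite lang; split=> [[f [fp ff wf wc]]|[q [qp qE /linearizationP[wq wc]]]].
  have [fp' f_last] := anxt_path fp.
  exists (q0 ++ flatten (map (@lab _ _ G) f)); split.
  - by rewrite cat_path q0p.
  - by rewrite last_cat f_last; case/andP: ff => /eqP.
  apply/linearizationP; split=> // p; rewrite wf.
  exact: profile_run vd_none vd_some run0 _ _ fp.
(* All runs begin with [q0], so only the rest is cut into phases; as a linearization depends on the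
   process words alone, erased cycles do not matter. *)
have [l2 qE2] := q0P q qp qE; rewrite qE2 cat_path last_cat in qp qE.
case/andP: qp => _ /annotE/(_ qE)[f [fp ff fE]]; exists f; split=> // p.
rewrite wq (profile_run vd_none vd_some run0 _ fp) qE2 !profile_path.
by rewrite -!cat_cons !map_cat !flatten_cat -[RHS]/(_ ++ flatten (map (prf p) _)) fE.
Qed.
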